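(* There is a quantum algorithm which, given $\varepsilon>0$ and oracle access to an unknown quantum $k$-junta $U\in\mathcal{U}_N$ on $n$ qubits, outputs, with probability at least $9/10$, a classical description of a unitary $\widehat{U}$ with $\mathrm{dist}(U,\widehat{U})\le\varepsilon$, and makes $O\!\left(\frac{k}{\varepsilon}+\frac{4^k}{\varepsilon^2}\right)$ queries to $U$.
   Context: $N=2^n$, $\mathcal{U}_N$ is the set of $N\times N$ unitaries. A unitary $U\in\mathcal{U}_N$ is a quantum $k$-junta if $U=V_S\otimes I_{\overline{S}}$ for some $S\subseteq[n]$ with $|S|=k$ and some $V_S\in\mathcal{U}_{2^k}$ acting on the qubits in $S$ (identity on the remaining qubits). For $A,B\in\mathbb{C}^{N\times N}$, $\mathrm{dist}(A,B):=\min_{\theta\in[0,2\pi)}\frac{1}{\sqrt{2N}}\|e^{i\theta}A-B\|$ with $\|\cdot\|$ the Frobenius norm. An oracle for $U$ maps $|\psi\rangle\mapsto U|\psi\rangle$. *)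

(* Defs.v *)
From HB Require Import structures.
From mathcomp Require Import all_boot all_order all_algebra.
From mathcomp Require Import complex mxtens.
From mathcomp Require Import boolp classical_sets reals.
Set Implicit Arguments. Unset Strict Implicit. Unset Printing Implicit Defensive.
Import Order.TTheory GRing.Theory Num.Theory.
Local Open Scope ring_scope.
Local Open Scope classical_set_scope.

Lemma pow2_gt0 (k : nat) : (0 < 2 ^ k)%N.
Proof. by rewrite expn_gt0. Qed.

Section Quantum.
Variable R : realType.
Local Notation C := R[i].

Definition cabs (z : C) : R := ComplexField.Normc.normc z.

Definition adjmx (m n : nat) (A : 'M[C]_(m, n)) : 'M[C]_(n, m) :=
  (map_mx (@conjc R) A)^T.

Definition unitary (d : nat) (A : 'M[C]_d) : Prop :=
  adjmx A *m A = 1%:M /\ A *m adjmx A = 1%:M.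

Definition frob (m n : nat) (A : 'M[C]_(m, n)) : R :=
  Num.sqrt (\sum_(i < m) \sum_(j < n) cabs (A i j) ^+ 2).

(* dist(A,B) = min over global phases e^{i theta} of ||e^{i theta} A - B|| / sqrt(2d);
   the minimum is attained, so it equals the infimum over unit-modulus c. *)
Definition qdist (d : nat) (A B : 'M[C]_d) : R :=
  inf [set frob (c *: A - B) / Num.sqrt (2 * d)%:R | c in [set c : C | cabs c = 1]].

Definition qbit (n : nat) (x : 'I_(2 ^ n)) (i : 'I_n) : bool :=
  odd (x %/ 2 ^ i).

Definition ordmod (k m : nat) : 'I_(2 ^ k) := Ordinal (ltn_pmod m (pow2_gt0 k)).

(* the basis index, in the 2^|S|-dimensional space of the qubits in S, of the
   restriction of x to S (qubits of S ordered by enum S) *)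
Definition restr_idx (n k : nat) (S : {set 'I_n}) (x : 'I_(2 ^ n)) : 'I_(2 ^ k) :=
  ordmod k (\sum_(i <- enum S) qbit x i * 2 ^ (index i (enum S))).

(* the matrix V_S (x) I_{complement of S} *)
Definition junta_mx (n k : nat) (S : {set 'I_n}) (V : 'M[C]_(2 ^ k)) : 'M[C]_(2 ^ n) :=
  \matrix_(x, y) (if [forall i in ~: S, qbit x i == qbit y i]
                  then V (restr_idx k S x) (restr_idx k S y) else 0).

Definition is_junta (n k : nat) (U : 'M[C]_(2 ^ n)) : Prop :=
  exists S : {set 'I_n}, #|S| = k /\
  exists V : 'M[C]_(2 ^ k), unitary V /\ U = junta_mx S V.

(* An algorithm with oracle access to U in U_{2^n} uses n + m qubits, starts in
   |0...0>, alternates fixed unitaries G_0, ..., G_T with T applications of the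
   oracle U (x) I_{2^m}, measures all qubits in the computational basis and
   outputs (by arbitrary classical post-processing of the outcome) a classical
   description of a unitary.  Intermediate measurements and adaptivity are
   covered by the principle of deferred measurement. *)
Record query_alg (n : nat) := QueryAlg {
  anc : nat;
  nqueries : nat;
  gate : nat -> 'M[C]_(2 ^ n * 2 ^ anc);
  gate_unitary : forall t, unitary (gate t);
  output : 'I_(2 ^ n * 2 ^ anc) -> 'M[C]_(2 ^ n);
  output_unitary : forall o, unitary (output o)
}.
Arguments anc {n} q.
Arguments nqueries {n} q.
Arguments gate {n} q _.
Arguments output {n} q _.

Lemma dim_gt0 (n m : nat) : (0 < 2 ^ n * 2 ^ m)%N.
Proof. by rewrite muln_gt0 !pow2_gt0. Qed.

Definition zero_idx (n m : nat) : 'I_(2 ^ n * 2 ^ m) := Ordinal (dim_gt0 n m).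

Fixpoint run_state (n : nat) (A : query_alg n) (U : 'M[C]_(2 ^ n)) (t : nat)
  : 'cV[C]_(2 ^ n * 2 ^ anc A) :=
  match t with
  | 0 => gate A 0 *m delta_mx (zero_idx n (anc A)) 0
  | t'.+1 => gate A t *m ((U *t (1%:M : 'M[C]_(2 ^ anc A))) *m run_state A U t')
  end.

Definition final_state (n : nat) (A : query_alg n) (U : 'M[C]_(2 ^ n)) :=
  run_state A U (nqueries A).

Definition success_prob (n : nat) (A : query_alg n) (U : 'M[C]_(2 ^ n)) (eps : R) : R :=
  \sum_(o < 2 ^ n * 2 ^ anc A | qdist U (output A o) <= eps)
     cabs (final_state A U o 0) ^+ 2.

End Quantum.

(* Main.v *)
Require Import Defs.
From HB Require Import structures.
From mathcomp Require Import all_boot all_order all_algebra.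
From mathcomp Require Import complex mxtens.
From mathcomp Require Import boolp classical_sets reals.
From mathcomp Require Import ring lra.
Import Order.TTheory GRing.Theory Num.Theory.
Local Open Scope ring_scope.
Set Implicit Arguments.
Unset Strict Implicit.
Unset Printing Implicit Defensive.

(** Since the distance never exceeds 1, no query is needed when eps >= 1; otherwise
    k / eps is dominated by 4^k / eps^2 and O(4^k / eps^2) copies of one fixed state
    suffice, each prepared with a single query: a superposition of U|0> and of the Choi
    state of U, next to a copy qubit in a uniform superposition.  In the basis made of
    computational vectors (for U|0>) and Pauli vectors (for the Choi state) the
    coordinates of this state are supported on subsets of the relevant set S.  All
    copies are prepared by one circuit and measured adaptively at the end, in three
    stages of m copies each.
    - Measuring in that basis, the union S' of the supports of the m outcomes misses
      weight at most k / m on average, because x (1 - x)^m <= 1 / m.  Moreover the first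
      outcome most likely is a basis vector y0 with |<y0|state>|^2 of order 2^-k.
    - Interfering a reference vector e on the first copy with d basis vectors on the
      second, under the phases 1, i, -1, -i, estimates the d products conj(<e, a>) a_j of
      the coordinates a with total mean square error d / m.  With e = y0 and the 2^k
      computational vectors over S' this gives a vector of constant overlap with U|0>.
    - With that vector as the new reference and the 4^k Pauli vectors over S', the same
      measurement gives the Pauli coefficients of U, up to a common factor of constant
      modulus, with square error O(4^k / m) = O(eps^2).  Any unitary whose Pauli
      coefficients are, up to a factor, that close to the estimate is within eps of U. *)

Local Notation Re := complex.Re.
Local Notation Im := complex.Im.
Local Notation "z ^*" := (conjc z) : ring_scope.
Local Notation "a %:C" := (real_complex _ a) : ring_scope.

(** * Squared modulus *)

Section SquaredModulus.
Variable R : realType.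
Local Notation C := R[i].
Implicit Types (x y z : C) (a : R).

Definition abs2 z : R := cabs z ^+ 2.

Lemma abs2E z : abs2 z = Re z ^+ 2 + Im z ^+ 2.
Proof. by case: z => a b; rewrite /abs2 /cabs /= sqr_sqrtr // addr_ge0 ?sqr_ge0. Qed.

Lemma abs2_ge0 z : 0 <= abs2 z.
Proof. exact: sqr_ge0. Qed.

Lemma cabs_ge0 z : 0 <= cabs z.
Proof. by case: z => a b; rewrite /cabs /= sqrtr_ge0. Qed.

Lemma cabsM x y : cabs (x * y) = cabs x * cabs y.
Proof. exact: ComplexField.Normc.normcM. Qed.

Lemma abs2M x y : abs2 (x * y) = abs2 x * abs2 y.
Proof. by rewrite /abs2 cabsM exprMn. Qed.

Lemma abs2_conj z : abs2 z^* = abs2 z.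
Proof. by rewrite !abs2E; case: z => a b /=; rewrite sqrrN. Qed.

Lemma abs2N z : abs2 (- z) = abs2 z.
Proof. by rewrite !abs2E; case: z => a b /=; rewrite !sqrrN. Qed.

Lemma abs2_real a : abs2 a%:C = a ^+ 2.
Proof. by rewrite abs2E /= expr0n addr0. Qed.

Lemma abs2_0 : abs2 0 = 0.
Proof. by rewrite (abs2_real 0) expr0n. Qed.

Lemma abs2_1 : abs2 1 = 1.
Proof. by rewrite (abs2_real 1) expr1n. Qed.

Lemma abs2_bool (b : bool) : abs2 b%:R = b%:R.
Proof. by case: b; rewrite ?abs2_1 ?abs2_0. Qed.

Lemma abs2_eq0 z : (abs2 z == 0) = (z == 0).
Proof.
rewrite sqrf_eq0; apply/eqP/eqP => [/ComplexField.Normc.eq0_normc //|->].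
exact: ComplexField.Normc.normc0.
Qed.

Lemma cabs_sqrt z : cabs z = Num.sqrt (abs2 z).
Proof. by rewrite sqrtr_sqr ger0_norm ?cabs_ge0. Qed.

Lemma mulJc z : z^* * z = (abs2 z)%:C.
Proof. by rewrite abs2E; case: z => a b; simpc; congr Complex; ring. Qed.

Lemma abs2B x y : abs2 (x - y) = abs2 x + abs2 y - 2 * Re (x^* * y).
Proof. by rewrite !abs2E; case: x => a b; case: y => c d /=; ring. Qed.

Lemma abs2_distC x y : abs2 (x - y) = abs2 (y - x).
Proof. by rewrite -abs2N opprB. Qed.

Lemma abs2_dist_le x y z : abs2 (x - z) <= 2 * abs2 (x - y) + 2 * abs2 (y - z).
Proof.
rewrite !abs2E; case: x => a b; case: y => c d; case: z => e f /=.
have := sqr_ge0 (a - c - (c - e)); have := sqr_ge0 (b - d - (d - f)); nra.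
Qed.

Lemma ReMr a z : Re (a%:C * z) = a * Re z.
Proof. by case: z => c d /=; rewrite mul0r subr0. Qed.

Lemma ImMr a z : Im (a%:C * z) = a * Im z.
Proof. by case: z => c d /=; rewrite mul0r addr0. Qed.

Lemma ReB x y : Re (x - y) = Re x - Re y.
Proof. by case: x; case: y. Qed.

Lemma ImB x y : Im (x - y) = Im x - Im y.
Proof. by case: x; case: y. Qed.

Lemma conjcM x y : (x * y)^* = x^* * y^*.
Proof. exact: rmorphM. Qed.

Lemma conjcD x y : (x + y)^* = x^* + y^*.
Proof. exact: rmorphD. Qed.

Section BigOperators.
Variables (T : Type) (r : seq T) (P : pred T) (F : T -> C).

Lemma Re_sum : Re (\sum_(i <- r | P i) F i) = \sum_(i <- r | P i) Re (F i).
Proof. by apply: (big_morph (@complex.Re R)) => // -[a b] [c d]. Qed.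

Lemma Im_sum : Im (\sum_(i <- r | P i) F i) = \sum_(i <- r | P i) Im (F i).
Proof. by apply: (big_morph (@complex.Im R)) => // -[a b] [c d]. Qed.

Lemma conjc_sum : (\sum_(i <- r | P i) F i)^* = \sum_(i <- r | P i) (F i)^*.
Proof. exact: (rmorph_sum (@conjc R)). Qed.

Lemma conjc_prod : (\prod_(i <- r | P i) F i)^* = \prod_(i <- r | P i) (F i)^*.
Proof. exact: (rmorph_prod (@conjc R)). Qed.

Lemma abs2_prod : abs2 (\prod_(i <- r | P i) F i) = \prod_(i <- r | P i) abs2 (F i).
Proof. exact: (big_morph abs2 abs2M abs2_1). Qed.

End BigOperators.
End SquaredModulus.

Arguments abs2 {R} z.

Section DeltaSums.
Variables (A : nzRingType) (T : finType).
Implicit Types (x : T) (F : T -> A).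

Lemma sum_deltal x F : \sum_y (x == y)%:R * F y = F x.
Proof.
rewrite (bigD1 x) //= eqxx mul1r big1 ?addr0 // => y.
by rewrite eq_sym => /negPf ->; rewrite mul0r.
Qed.

Lemma sum_delta_sym x F : \sum_y (y == x)%:R * F y = F x.
Proof. by under eq_bigr => y _ do rewrite eq_sym; exact: sum_deltal. Qed.

Lemma sum_deltar x F : \sum_y F y * (x == y)%:R = F x.
Proof.
rewrite (bigD1 x) //= eqxx mulr1 big1 ?addr0 // => y.
by rewrite eq_sym => /negPf ->; rewrite mulr0.
Qed.

Lemma sum_mem (B : {set T}) : \sum_x (x \in B)%:R = #|B|%:R :> A.
Proof.
by rewrite -sum1_card natr_sum [RHS]big_mkcond; apply: eq_bigr => x _; case: (x \in B).
Qed.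

End DeltaSums.

Lemma sum_bool_prod (V : nmodType) (T : finType) (F : bool * T -> V) :
  \sum_i F i = \sum_t F (true, t) + \sum_t F (false, t).
Proof.
by rewrite -(big_bool _ (fun b => \sum_t F (b, t))) pair_bigA; apply: eq_bigr => -[].
Qed.

(** * Complex vectors indexed by finite types *)

Section InnerProduct.
Variables (R : realType) (T : finType).
Local Notation C := R[i].
Implicit Types (f g h : T -> C) (r k : C) (x : T) (B : {set T}).

Definition dot f g : C := \sum_x (f x)^* * g x.

Definition sqnorm f : R := \sum_x abs2 (f x).

Definition ket x : T -> C := fun y => (y == x)%:R.

Definition restrict B f : T -> C := fun x => (x \in B)%:R * f x.

Lemma sqnorm_ge0 f : 0 <= sqnorm f.
Proof. by apply: sumr_ge0 => x _; apply: abs2_ge0. Qed.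

Lemma sqnorm0_eq0 f x : sqnorm f = 0 -> f x = 0.
Proof.
move=> /eqP; rewrite psumr_eq0 => [/allP/(_ x)|y _]; last exact: abs2_ge0.
by rewrite mem_index_enum abs2_eq0 => /(_ isT)/eqP.
Qed.

Lemma dotxx f : dot f f = (sqnorm f)%:C.
Proof.
by rewrite (rmorph_sum (real_complex R)); apply: eq_bigr => x _; rewrite mulJc.
Qed.

Lemma dot_conj f g : (dot f g)^* = dot g f.
Proof. by rewrite conjc_sum; apply: eq_bigr => x _; rewrite conjcM conjcK mulrC. Qed.

Lemma dotZl r f g : dot (fun x => r * f x) g = r^* * dot f g.
Proof. by rewrite mulr_sumr; apply: eq_bigr => x _; rewrite conjcM mulrA. Qed.

Lemma sqnormZ r f : sqnorm (fun x => r * f x) = abs2 r * sqnorm f.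
Proof. by rewrite mulr_sumr; apply: eq_bigr => x _; rewrite abs2M. Qed.

Lemma sqnorm_ket x : sqnorm (ket x) = 1.
Proof.
rewrite -(sum_delta_sym x (fun=> 1)); apply: eq_bigr => y _.
by rewrite abs2_bool mulr1.
Qed.

Lemma dot_ketl x f : dot (ket x) f = f x.
Proof. by rewrite -[RHS]sum_delta_sym; apply: eq_bigr => y _; rewrite conjc_nat. Qed.

Lemma dot_restrict B f g : {in ~: B, forall x, f x = 0} -> dot f (restrict B g) = dot f g.
Proof.
move=> f0; apply: eq_bigr => x _; rewrite /restrict.
by case: (boolP (x \in B)) => xB; rewrite ?mul1r // f0 ?inE // conjc0 !mul0r.
Qed.

Lemma sqnormB r k f g : sqnorm (fun x => r * f x - k * g x) =
  abs2 r * sqnorm f + abs2 k * sqnorm g - 2 * Re (r^* * k * dot f g).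
Proof.
rewrite /dot !mulr_sumr Re_sum mulr_sumr -big_split -sumrB; apply: eq_bigr => x _ /=.
by rewrite abs2B !abs2M conjcM [_ * _ * (k * _)]mulrACA.
Qed.

Lemma sqnorm_distC f g : sqnorm (fun x => f x - g x) = sqnorm (fun x => g x - f x).
Proof. by apply: eq_bigr => x _; apply: abs2_distC. Qed.

Lemma sqnorm_dist_le f g h :
  sqnorm (fun x => f x - h x) <=
  2 * sqnorm (fun x => f x - g x) + 2 * sqnorm (fun x => g x - h x).
Proof.
by rewrite /sqnorm !mulr_sumr -big_split ler_sum // => x _; apply: abs2_dist_le.
Qed.

Lemma cauchy_schwarz f g : abs2 (dot f g) <= sqnorm f * sqnorm g.
Proof.
have [f_eq0|f_neq0] := eqVneq (sqnorm f) 0.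
  rewrite f_eq0 mul0r /dot big1 ?abs2_0 // => x _.
  by rewrite (sqnorm0_eq0 x f_eq0) conjc0 mul0r.
have f_gt0 : 0 < sqnorm f by rewrite lt_def f_neq0 sqnorm_ge0.
have := sqnorm_ge0 (fun x => dot f g * f x - (sqnorm f)%:C * g x).
rewrite sqnormB [_^* * _ * _]mulrAC mulJc -(rmorphM (real_complex R)) abs2_real /=.
by move=> gram_ge0; rewrite -(ler_pM2l f_gt0); lra.
Qed.

(* The squared distance from [k g] to the line spanned by [f] is, up to the factor
   [sqnorm f], the Gram determinant on the left. *)
Lemma gram_le_sqnormB r k f g :
  abs2 k * (sqnorm f * sqnorm g - abs2 (dot f g)) <=
  sqnorm f * sqnorm (fun x => r * f x - k * g x).
Proof.
have cross : Re (((sqnorm f)%:C * r)^* * (k * dot f g)) =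
    sqnorm f * Re (r^* * k * dot f g).
  by rewrite conjcM conjc_real -!mulrA ReMr.
have := abs2_ge0 ((sqnorm f)%:C * r - k * dot f g).
by rewrite sqnormB abs2B cross !abs2M abs2_real; lra.
Qed.

Lemma overlap_of_close f g k : 0 < sqnorm g -> k != 0 ->
  sqnorm (fun x => f x - k * g x) <= abs2 k * sqnorm g / 4 ->
  0 < sqnorm f /\ 3 / 4 * (sqnorm f * sqnorm g) <= abs2 (dot f g).
Proof.
move=> g_gt0 k_neq0 close.
have k_gt0 : 0 < abs2 k by rewrite lt_def abs2_eq0 k_neq0 abs2_ge0.
have kg_gt0 := mulr_gt0 k_gt0 g_gt0.
split.
  rewrite lt_def sqnorm_ge0 andbT; apply/eqP => f_eq0; move: close.
  suff -> : sqnorm (fun x => f x - k * g x) = abs2 k * sqnorm g by lra.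
  by rewrite -sqnormZ; apply: eq_bigr => x _; rewrite (sqnorm0_eq0 x f_eq0) sub0r abs2N.
have := gram_le_sqnormB 1 k f g; have := ler_wpM2l (sqnorm_ge0 f) close.
rewrite (_ : sqnorm (fun x => 1 * f x - _) = sqnorm (fun x => f x - k * g x)).
  by move=> scaled_close gram; rewrite -(ler_pM2l k_gt0); lra.
by apply: eq_bigr => x _; rewrite mul1r.
Qed.

Definition normalize (e : T -> C) f : T -> C :=
  if sqnorm f == 0 then e else fun x => (Num.sqrt (sqnorm f))^-1%:C * f x.

Lemma sqnorm_normalize e f : sqnorm e = 1 -> sqnorm (normalize e f) = 1.
Proof.
rewrite /normalize; case: ifPn => // f0 _.
by rewrite sqnormZ abs2_real exprVn sqr_sqrtr ?mulVf ?sqnorm_ge0.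
Qed.

Lemma abs2_dot_normalize e f g : 0 < sqnorm f ->
  abs2 (dot (normalize e f) g) = abs2 (dot f g) / sqnorm f.
Proof.
move=> f0; rewrite /normalize gt_eqF // dotZl conjc_real abs2M abs2_real exprVn.
by rewrite sqr_sqrtr ?sqnorm_ge0 // mulrC.
Qed.

End InnerProduct.

Arguments ket R {T} x.

(** * Probability on finite types *)

Section FiniteProbability.
Variables (R : realType) (O : finType).
Implicit Types (p : O -> R) (A B : pred O) (f : O -> R).

Definition distribution p := (forall o, 0 <= p o) /\ \sum_o p o = 1.

Definition prob p A : R := \sum_(o | A o) p o.

Lemma probE p A : prob p A = \sum_o p o * (A o)%:R.
Proof.
by rewrite /prob big_mkcond; apply: eq_bigr => o _; case: (A o); rewrite ?mulr1 ?mulr0.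
Qed.

Lemma prob_le p A B : distribution p -> (forall o, A o -> B o) -> prob p A <= prob p B.
Proof.
move=> [p0 _] AB; rewrite !probE ler_sum // => o _; rewrite ler_wpM2l // ler_nat.
by case: (boolP (A o)) => // /AB ->.
Qed.

Lemma probC p A : distribution p -> prob p A = 1 - prob p (predC A).
Proof. by move=> [_ p1]; rewrite -p1 (bigID A) /= addrK. Qed.

Lemma prob_almost_surely p A :
  distribution p -> (forall o, p o != 0 -> A o) -> prob p A = 1.
Proof.
move=> dp pA; rewrite probC // /prob big1 ?subr0 // => o.
exact: contraNeq (pA o).
Qed.

Lemma union_bound p A B (a b : R) : distribution p ->
  1 - a <= prob p A -> 1 - b <= prob p B -> 1 - (a + b) <= prob p (predI A B).
Proof.
move=> dp; rewrite (probC A dp) (probC B dp) (probC (predI A B) dp) => pA pB.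
suff : prob p (predC (predI A B)) <= prob p (predC A) + prob p (predC B) by lra.
rewrite !probE -big_split ler_sum //= => o _; rewrite -mulrDr ler_wpM2l ?(proj1 dp) //=.
by case: (A o); case: (B o); rewrite /= ?addr0 ?add0r // lerDl.
Qed.

Lemma markov p f (c : R) : distribution p -> (forall o, 0 <= f o) -> 0 < c ->
  1 - (\sum_o p o * f o) / c <= prob p (fun o => f o <= c).
Proof.
move=> dp f0 c0; rewrite (probC _ dp) lerD2l lerN2 ler_pdivlMr // probE mulr_suml.
case: dp => p0 _; rewrite ler_sum // => o _; rewrite -mulrA ler_wpM2l //=.
by case: (ltP c (f o)) => [/ltW|]; rewrite ?mul1r ?mul0r.
Qed.

Lemma variance_le_moment p f : distribution p ->
  \sum_o p o * (f o - \sum_x p x * f x) ^+ 2 <= \sum_o p o * f o ^+ 2.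
Proof.
move=> [_ p1]; set e := \sum_x p x * f x.
have -> : \sum_o p o * (f o - e) ^+ 2 = \sum_o p o * f o ^+ 2 - e ^+ 2.
  rewrite (eq_bigr (fun o => p o * f o ^+ 2 - p o * f o * (2 * e) + p o * e ^+ 2)).
    by rewrite big_split sumrB -!mulr_suml p1 -/e /=; ring.
  by move=> o _; ring.
by rewrite gerBl sqr_ge0.
Qed.

End FiniteProbability.

Section SequentialSampling.
Variables (R : realType) (O1 O2 : finType) (p1 : O1 -> R) (p2 : O1 -> O2 -> R).
Hypothesis p1_distr : distribution p1.
Hypothesis p2_distr : forall o, distribution (p2 o).

Definition chain (o : O1 * O2) : R := p1 o.1 * p2 o.1 o.2.

Lemma chain_distribution : distribution chain.
Proof.
split=> [o|]; first by rewrite mulr_ge0 ?(proj1 p1_distr) ?(proj1 (p2_distr _)).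
rewrite -(pair_bigA _ (fun o1 o2 => p1 o1 * p2 o1 o2)) /= -(proj2 p1_distr).
by apply: eq_bigr => o _; rewrite -mulr_sumr (proj2 (p2_distr o)) mulr1.
Qed.

Lemma prob_chain_ge (A1 : pred O1) (A : pred (O1 * O2)) (q r : R) :
  0 <= r -> q <= prob p1 A1 ->
  (forall o, A1 o -> r <= prob (p2 o) (fun o' => A (o, o'))) -> q * r <= prob chain A.
Proof.
move=> r0 pA1 pA; apply: (@le_trans _ _ (prob p1 A1 * r)); first by rewrite ler_wpM2r.
have -> : prob chain A = \sum_o p1 o * prob (p2 o) (fun o' => A (o, o')).
  under [RHS]eq_bigr do rewrite probE mulr_sumr.
  by rewrite probE pair_bigA; apply: eq_bigr => -[o1 o2] _; rewrite mulrA.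
rewrite mulr_suml big_mkcond ler_sum // => o _; have p1o := proj1 p1_distr o.
case: ifP => [/pA|_]; first exact: ler_wpM2l.
by rewrite mulr_ge0 ?sumr_ge0 // => o' _; apply: proj1 (p2_distr o) o'.
Qed.

End SequentialSampling.

Section IndependentSamples.
Variables (R : realType) (O : finType) (p : O -> R) (m : nat).
Hypothesis p_distr : distribution p.
Implicit Type o : {ffun 'I_m -> O}.

Definition iid o : R := \prod_k p (o k).

Lemma iid_prod (h : 'I_m -> O -> R) :
  \sum_o iid o * \prod_k h k (o k) = \prod_k \sum_x p x * h k x.
Proof. by rewrite bigA_distr_bigA; apply: eq_bigr => o _; rewrite big_split. Qed.

Lemma iid_distribution : distribution iid.
Proof.
split=> [o|]; first by apply: prodr_ge0 => k _; case: p_distr.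
transitivity (\prod_(k < m) \sum_x p x * 1).
  by rewrite -iid_prod; apply: eq_bigr => o _; rewrite big1 ?mulr1.
by rewrite -mulr_suml (proj2 p_distr) mulr1 big1.
Qed.

Lemma iid_marginal (k : 'I_m) (g : O -> R) :
  \sum_o iid o * g (o k) = \sum_x p x * g x.
Proof.
pose h (i : 'I_m) x := if i == k then g x else 1.
transitivity (\prod_i \sum_x p x * h i x).
  rewrite -iid_prod; apply: eq_bigr => o _.
  by rewrite -big_mkcond big_pred1_eq.
rewrite (bigD1 k) //= [X in _ * X]big1 ?mulr1 => [|i /negPf ik].
  by apply: eq_bigr => x _; rewrite /h eqxx.
by under eq_bigr do rewrite /h ik mulr1; case: p_distr.
Qed.

Lemma prob_iid_coord (k : 'I_m) (A : pred O) : prob iid (fun o => A (o k)) = prob p A.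
Proof. by rewrite !probE (iid_marginal k (fun x => (A x)%:R)). Qed.

Lemma prob_iid_all (A : pred O) : prob iid (fun o => [forall k, A (o k)]) = prob p A ^+ m.
Proof.
transitivity (\prod_(k < m) \sum_x p x * (A x)%:R).
  rewrite -iid_prod probE; apply: eq_bigr => o _; congr (_ * _).
  case: forallP => [all|/forallP]; first by rewrite big1 // => k _; rewrite all.
  by rewrite negb_forall => /existsP[k /negPf Ak]; rewrite (bigD1 k) //= Ak mul0r.
by rewrite prodr_const card_ord -probE.
Qed.

Lemma iid_covariance (g : O -> R) (k l : 'I_m) : \sum_x p x * g x = 0 ->
  \sum_o iid o * (g (o k) * g (o l)) = (k == l)%:R * \sum_x p x * g x ^+ 2.
Proof.
move=> g0; have [<-|/negPf kl] := eqVneq k l.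
  by rewrite mul1r -(iid_marginal k); apply: eq_bigr => o _; rewrite expr2.
pose h (i : 'I_m) x := if (i == k) || (i == l) then g x else 1.
transitivity (\prod_i \sum_x p x * h i x).
  rewrite -iid_prod; apply: eq_bigr => o _; congr (_ * _).
  rewrite -big_mkcond (bigD1 k) ?eqxx //= (bigD1 l) ?eqxx ?orbT 1?eq_sym ?kl //=.
  by rewrite big1 ?mulr1 // => i /andP[/andP[/orP[]/eqP-> ]]; rewrite eqxx.
by rewrite mul0r (bigD1 k) //= /h eqxx g0 mul0r.
Qed.

Lemma iid_variance (f : O -> R) : (0 < m)%N ->
  \sum_o iid o * (m%:R^-1 * (\sum_k f (o k)) - \sum_x p x * f x) ^+ 2
    <= m%:R^-1 * \sum_x p x * f x ^+ 2.
Proof.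
move=> m0; set e := \sum_x p x * f x; pose g x := f x - e.
have m_neq0 : m%:R != 0 :> R by rewrite pnatr_eq0 -lt0n.
have g0 : \sum_x p x * g x = 0.
  under eq_bigr do rewrite mulrBr.
  by rewrite sumrB -mulr_suml (proj2 p_distr) mul1r subrr.
have centered o : m%:R^-1 * (\sum_k f (o k)) - e = m%:R^-1 * \sum_k g (o k).
  by rewrite sumrB sumr_const card_ord -[e *+ m]mulr_natl mulrBr mulKf.
have -> : \sum_o iid o * (m%:R^-1 * (\sum_k f (o k)) - e) ^+ 2 =
    m%:R^-2 * \sum_k \sum_l \sum_o iid o * (g (o k) * g (o l)).
  under [in RHS]eq_bigr do rewrite exchange_big.
  rewrite exchange_big mulr_sumr; apply: eq_bigr => o _.
  rewrite centered exprMn exprVn [(\sum__ _) ^+ 2]expr2 mulr_suml mulrCA mulr_sumr.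
  congr (_ * _).
  by apply: eq_bigr => k _; rewrite !mulr_sumr.
under eq_bigr => k _ do under eq_bigr => l _ do rewrite iid_covariance //.
under eq_bigr do rewrite sum_deltal.
rewrite sumr_const card_ord -[X in _ * X <= _]mulr_natl mulrA expr2 invfM mulfVK //.
by rewrite ler_wpM2l ?invr_ge0 ?variance_le_moment.
Qed.

Lemma iid_variance_complex (f : O -> R[i]) : (0 < m)%N ->
  \sum_o iid o * abs2 ((m%:R^-1)%:C * (\sum_k f (o k)) - \sum_x (p x)%:C * f x)
    <= m%:R^-1 * \sum_x p x * abs2 (f x).
Proof.
move=> m0; have -> : \sum_x p x * abs2 (f x)
    = (\sum_x p x * Re (f x) ^+ 2) + \sum_x p x * Im (f x) ^+ 2.
  by rewrite -big_split; apply: eq_bigr => x _; rewrite abs2E mulrDr.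
rewrite mulrDr; apply: le_trans (lerD (iid_variance (fun x => Re (f x)) m0)
                                     (iid_variance (fun x => Im (f x)) m0)).
rewrite -big_split ler_sum // => o _ /=; rewrite -mulrDr abs2E ReB ImB ReMr ImMr.
rewrite !Re_sum !Im_sum; under [\sum_i Re (_ * _)]eq_bigr do rewrite ReMr.
by under [\sum_i Im (_ * _)]eq_bigr do rewrite ImMr.
Qed.

End IndependentSamples.

Arguments iid {R O} p {m} o.

(* [x] times the geometric sum of [1 - x] is [1 - (1 - x) ^+ m], hence at most 1. *)
Lemma mul_exp_compl_le (R : realFieldType) (x : R) (m : nat) : (0 < m)%N ->
  0 <= x <= 1 -> x * (1 - x) ^+ m <= m%:R^-1.
Proof.
move=> m0 /andP[x0 x1]; have [y0 y1] : 0 <= 1 - x /\ 1 - x <= 1 by split; lra.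
have mpos : 0 < m%:R :> R by rewrite ltr0n.
rewrite -(ler_pM2l mpos) mulfV ?gt_eqF //.
apply: (@le_trans _ _ (1 - (1 - x) ^+ m)); last by rewrite gerBl exprn_ge0.
rewrite -[leRHS]opprB subrX1 -mulNr opprB subKr mulrCA ler_wpM2l // mulr_natl.
rewrite -[X in _ *+ X <= _](card_ord m) -sumr_const ler_sum // => i _.
by rewrite ler_wiXn2l // ltnW.
Qed.

(** * Unitary matrices *)

Section UnitaryMatrices.
Variable R : realType.
Local Notation C := R[i].

Lemma adjmxE m n (A : 'M[C]_(m, n)) i j : adjmx A i j = (A j i)^*.
Proof. by rewrite !mxE. Qed.

Lemma adjmxK m n (A : 'M[C]_(m, n)) : adjmx (adjmx A) = A.
Proof. by apply/matrixP => i j; rewrite !adjmxE conjcK. Qed.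

Lemma adjmxM m n p (A : 'M[C]_(m, n)) (B : 'M[C]_(n, p)) :
  adjmx (A *m B) = adjmx B *m adjmx A.
Proof. by rewrite /adjmx map_mxM trmx_mul. Qed.

Lemma adjmxD m n (A B : 'M[C]_(m, n)) : adjmx (A + B) = adjmx A + adjmx B.
Proof. by rewrite /adjmx map_mxD raddfD. Qed.

Lemma adjmxN m n (A : 'M[C]_(m, n)) : adjmx (- A) = - adjmx A.
Proof. by rewrite /adjmx map_mxN raddfN. Qed.

Lemma adjmx1 n : adjmx (1%:M : 'M[C]_n) = 1%:M.
Proof. by rewrite /adjmx map_mx1 trmx1. Qed.

Lemma adjmx0 m n : adjmx (0 : 'M[C]_(m, n)) = 0.
Proof. by rewrite /adjmx map_mx0 trmx0. Qed.

Lemma unitary_of_isometry n (A : 'M[C]_n) : adjmx A *m A = 1%:M -> unitary A.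
Proof. by move=> AA; split => //; apply: mulmx1C. Qed.

Lemma unitary1 n : unitary (1%:M : 'M[C]_n).
Proof. by apply: unitary_of_isometry; rewrite adjmx1 mul1mx. Qed.

Lemma unitaryM n (A B : 'M[C]_n) : unitary A -> unitary B -> unitary (A *m B).
Proof.
move=> [AA _] [BB _]; apply: unitary_of_isometry.
by rewrite adjmxM mulmxA -(mulmxA (adjmx B)) AA mulmx1.
Qed.

Lemma sqnorm_unitary_col n (U : 'M[C]_n) y : unitary U -> sqnorm (U^~ y) = 1.
Proof.
move=> [UU _]; apply: (@complexI R); rewrite -dotxx.
have := congr1 (fun M : 'M_n => M y y) UU; rewrite !mxE eqxx; apply: etrans.
by apply: eq_bigr => x _; rewrite adjmxE.
Qed.

Section Exchange.
Variables (d q : nat) (A J : 'M[C]_(d, q)).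
Hypothesis A_isometry : adjmx A *m A = 1%:M.
Hypothesis J_isometry : adjmx J *m J = 1%:M.
Hypothesis AJ_orthogonal : adjmx A *m J = 0.

(* Exchanges the ranges of two isometries with orthogonal ranges and fixes the
   complement: any isometry becomes part of a unitary without completing a basis. *)
Definition exchange_mx : 'M[C]_d :=
  A *m adjmx J + J *m adjmx A + (1%:M - A *m adjmx A - J *m adjmx J).

Lemma exchange_mxr : exchange_mx *m J = A.
Proof.
rewrite /exchange_mx !(mulmxDl, mulNmx) mul1mx -!mulmxA J_isometry AJ_orthogonal.
by rewrite !mulmx0 !mulmx1 addr0 subr0 subrr addr0.
Qed.

Lemma exchange_mxl : exchange_mx *m A = J.
Proof.
have JA : adjmx J *m A = 0 by rewrite -[A]adjmxK -adjmxM AJ_orthogonal adjmx0.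
rewrite /exchange_mx !(mulmxDl, mulNmx) mul1mx -!mulmxA A_isometry JA.
by rewrite !mulmx0 !mulmx1 add0r subr0 subrr addr0.
Qed.

Lemma exchange_mx_unitary : unitary exchange_mx.
Proof.
have selfadjoint : adjmx exchange_mx = exchange_mx.
  rewrite /exchange_mx !(adjmxD, adjmxN, adjmxM, adjmxK) adjmx1.
  by rewrite (addrC (J *m _)).
apply: unitary_of_isometry; rewrite selfadjoint {2}/exchange_mx.
rewrite !(mulmxDr, mulmxN) mulmx1 !mulmxA exchange_mxl exchange_mxr /exchange_mx.
by apply/matrixP => i j; rewrite !mxE; ring.
Qed.

End Exchange.
End UnitaryMatrices.

(** * Distance up to a global phase *)

Section PhaseDistance.
Variables (R : realType) (d : nat).
Local Notation C := R[i].
Implicit Types (U W : 'M[C]_d) (eps : R).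

Definition entries U (xy : 'I_d * 'I_d) : C := U xy.1 xy.2.

Lemma sqnorm_entries U : sqnorm (entries U) = \sum_y sqnorm (U^~ y).
Proof. by rewrite exchange_big pair_bigA. Qed.

Lemma frobE U : frob U = Num.sqrt (sqnorm (entries U)).
Proof. by rewrite sqnorm_entries exchange_big. Qed.

Lemma sqnorm_unitary U : unitary U -> sqnorm (entries U) = d%:R.
Proof.
move=> uU; rewrite sqnorm_entries; under eq_bigr do rewrite sqnorm_unitary_col //.
by rewrite sumr_const card_ord.
Qed.

Lemma exists_aligning_phase (z : C) : exists2 c : C, cabs c = 1 & Re (c^* * z) = cabs z.
Proof.
have [->|z0] := eqVneq z 0.
  exists 1; first by rewrite cabs_sqrt abs2_1 sqrtr1.
  by rewrite mulr0 cabs_sqrt abs2_0 sqrtr0.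
have cz0 : cabs z != 0 by rewrite -sqrf_eq0 -/(abs2 z) abs2_eq0.
exists ((cabs z)^-1%:C * z).
  by rewrite cabs_sqrt abs2M abs2_real exprVn mulVf ?sqrtr1 // abs2_eq0.
by rewrite conjcM conjc_real -mulrA mulJc ReMr /= /abs2 expr2 mulKf.
Qed.

Lemma qdist_le_frob U W (c : C) : cabs c = 1 ->
  qdist U W <= frob (c *: U - W) / Num.sqrt (2 * d)%:R.
Proof.
move=> c1; apply: ge_inf; last by exists c.
by exists 0 => _ [c' _ <-]; rewrite divr_ge0 ?sqrtr_ge0.
Qed.

Hypothesis d_gt0 : (0 < d)%N.

Lemma qdist_le_overlap U W eps : unitary U -> unitary W -> 0 <= eps ->
  d%:R - cabs (dot (entries U) (entries W)) <= d%:R * eps ^+ 2 -> qdist U W <= eps.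
Proof.
move=> uU uW eps0 overlap.
have [c c1 cUW] := exists_aligning_phase (dot (entries U) (entries W)).
apply: le_trans (qdist_le_frob U W c1) _.
rewrite ler_pdivrMr ?sqrtr_gt0 ?ltr0n ?muln_gt0 // -[eps in leRHS]ger0_norm //.
rewrite -sqrtr_sqr -sqrtrM ?sqr_ge0 // frobE ler_sqrt ?mulr_ge0 ?sqr_ge0 //.
rewrite (_ : sqnorm _ = sqnorm (fun xy => c * entries U xy - 1 * entries W xy)).
  rewrite sqnormB !sqnorm_unitary // mulr1 cUW abs2_1 /abs2 c1 expr1n natrM; lra.
by apply: eq_bigr => xy _; rewrite /entries !mxE mul1r.
Qed.

Lemma qdist_le1 U W : unitary U -> unitary W -> qdist U W <= 1.
Proof.
move=> uU uW; apply: qdist_le_overlap => //.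
by rewrite expr1n mulr1 gerBl cabs_ge0.
Qed.

Lemma qdist_le_scaled U W (r k : C) eps : unitary U -> unitary W -> 0 <= eps -> k != 0 ->
  sqnorm (entries (r *: W - k *: U)) <= eps ^+ 2 * abs2 k * d%:R -> qdist U W <= eps.
Proof.
move=> uU uW eps0 kneq0 close; apply: qdist_le_overlap => //.
rewrite -dot_conj cabs_sqrt abs2_conj -cabs_sqrt.
have k0 : 0 < abs2 k by rewrite lt_def abs2_eq0 kneq0 abs2_ge0.
have d0 : 0 < d%:R :> R by rewrite ltr0n.
have := gram_le_sqnormB r k (entries W) (entries U).
rewrite (_ : sqnorm (fun xy => _ - _) = sqnorm (entries (r *: W - k *: U))); last first.
  by apply: eq_bigr => xy _; rewrite /entries !mxE.
rewrite (sqnorm_unitary uU) (sqnorm_unitary uW).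
move=> /le_trans/(_ (ler_wpM2l (ltW d0) close)).
have -> : d%:R * (eps ^+ 2 * abs2 k * d%:R) = abs2 k * (d%:R * (d%:R * eps ^+ 2)) by ring.
rewrite ler_pM2l // => gram; rewrite -(ler_pM2l d0); apply: le_trans gram.
set h := cabs _; have h0 : 0 <= h := cabs_ge0 _.
have hd : h <= d%:R.
  have := cauchy_schwarz (entries W) (entries U).
  by rewrite (sqnorm_unitary uU) (sqnorm_unitary uW) -expr2 ler_sqr ?nnegrE // ltW.
by rewrite /abs2 -/h; nra.
Qed.

End PhaseDistance.

(** * Measurements *)

Section Measurements.
Variable R : realType.
Local Notation C := R[i].

(* The vectors [w o] are the columns of a rank-one measurement: they need be neither
   unit vectors nor orthogonal, only a resolution of the identity. *)
Definition povm (I O : finType) (w : O -> I -> C) :=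
  forall x x', \sum_o w o x * (w o x')^* = (x == x')%:R.

Definition born (I O : finType) (w : O -> I -> C) (psi : I -> C) (o : O) : R :=
  abs2 (dot (w o) psi).

Lemma povm_sum (I O : finType) (w : O -> I -> C) (f g : I -> C) : povm w ->
  \sum_o (\sum_i w o i * f i) * (\sum_i w o i * g i)^* = \sum_i f i * (g i)^*.
Proof.
move=> w_povm.
transitivity (\sum_i \sum_j f i * (g j)^* * \sum_o w o i * (w o j)^*).
  under [RHS]eq_bigr do under eq_bigr do rewrite mulr_sumr.
  under [RHS]eq_bigr do rewrite exchange_big.
  rewrite [RHS]exchange_big; apply: eq_bigr => o _ /=.
  rewrite conjc_sum mulr_suml; apply: eq_bigr => i _.
  by rewrite mulr_sumr; apply: eq_bigr => j _; rewrite conjcM; ring.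
apply: eq_bigr => i _; under eq_bigr do rewrite w_povm.
by rewrite sum_deltar.
Qed.

Lemma sqnorm_povm (I O : finType) (w : O -> I -> C) psi :
  povm w -> sqnorm (fun o => dot (w o) psi) = sqnorm psi.
Proof.
move=> w_povm; apply: (@complexI R); rewrite -!dotxx.
transitivity (\sum_o (\sum_i w o i * (psi i)^*) * (\sum_i w o i * (psi i)^*)^*).
  have dotC o : \sum_i w o i * (psi i)^* = (dot (w o) psi)^*.
    by rewrite dot_conj; apply: eq_bigr => i _; rewrite mulrC.
  by apply: eq_bigr => o _; rewrite dotC conjcK.
by rewrite povm_sum //; apply: eq_bigr => i _; rewrite conjcK.
Qed.

Lemma born_distribution (I O : finType) (w : O -> I -> C) psi :
  povm w -> sqnorm psi = 1 -> distribution (born w psi).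
Proof.
move=> w_povm psi1; split=> [o|]; first exact: abs2_ge0.
by rewrite -psi1 -(sqnorm_povm _ w_povm).
Qed.

Section Composition.
Variables (X I O : finType) (E : I -> X -> C) (v : O -> I -> C).

Definition povm_comp (o : O) (x : X) : C := \sum_i v o i * E i x.

Lemma povm_compP : povm E -> povm v -> povm povm_comp.
Proof. by move=> E_povm v_povm x x'; rewrite povm_sum // -E_povm. Qed.

Lemma dot_povm_comp psi o : dot (povm_comp o) psi = dot (v o) (fun i => dot (E i) psi).
Proof.
rewrite /dot; under [RHS]eq_bigr do rewrite mulr_sumr.
rewrite exchange_big; apply: eq_bigr => x _ /=.
rewrite conjc_sum mulr_suml; apply: eq_bigr => i _.
by rewrite conjcM mulrA.
Qed.

End Composition.

Section TensorPower.
Variables (I O : finType) (m : nat) (w : O -> I -> C).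

Definition tensor_power (f : I -> C) (z : {ffun 'I_m -> I}) : C := \prod_k f (z k).

Definition povm_power (o : {ffun 'I_m -> O}) (z : {ffun 'I_m -> I}) : C :=
  \prod_k w (o k) (z k).

Lemma povm_powerP : povm w -> povm povm_power.
Proof.
move=> w_povm z z'; under eq_bigr do rewrite conjc_prod -big_split /=.
rewrite -(bigA_distr_bigA (fun k o => w o (z k) * (w o (z' k))^*)) /=.
under eq_bigr do rewrite w_povm.
have [->|] := eqVneq z z'; first by rewrite big1 // => k _; rewrite eqxx.
move=> /eqP/ffunP/existsNP[k /eqP/negPf zk].
by rewrite (bigD1 k) //= zk mul0r.
Qed.

Lemma dot_povm_power psi o :
  dot (povm_power o) (tensor_power psi) = \prod_k dot (w (o k)) psi.
Proof.
by rewrite bigA_distr_bigA; apply: eq_bigr => z _; rewrite conjc_prod big_split.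
Qed.

Lemma born_povm_power psi : born povm_power (tensor_power psi) =1 iid (born w psi).
Proof. by move=> o; rewrite /born dot_povm_power abs2_prod. Qed.

Lemma sqnorm_tensor_power f : sqnorm (tensor_power f) = sqnorm f ^+ m.
Proof.
rewrite /sqnorm; under eq_bigr do rewrite abs2_prod.
by rewrite -(bigA_distr_bigA (fun _ x => abs2 (f x))) prodr_const card_ord.
Qed.

End TensorPower.
End Measurements.

Arguments tensor_power {R I} m f z.
Arguments povm_power {R I O m} w o z.

(** * Measuring independent copies by a circuit *)

Section Pushforward.
Variables (R : realType) (T Y : finType) (h : T -> Y).
Local Notation C := R[i].
Implicit Types (f : T -> C) (g : Y -> C).

Definition pushforward f : Y -> C := fun y => \sum_t f t * (y == h t)%:R.

Lemma dot_pushforward f g : dot (pushforward f) g = dot f (g \o h).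
Proof.
rewrite /dot; under eq_bigr do rewrite conjc_sum mulr_suml.
rewrite exchange_big; apply: eq_bigr => t _ /=.
rewrite -(sum_delta_sym (h t) g) mulr_sumr; apply: eq_bigr => y _.
by rewrite conjcM conjc_nat mulrA.
Qed.

Lemma pushforward_inj f t : injective h -> pushforward f (h t) = f t.
Proof.
move=> h_inj; rewrite /pushforward; under eq_bigr do rewrite (inj_eq h_inj).
exact: sum_deltar.
Qed.

Lemma pushforward_off f y : (forall t, y != h t) -> pushforward f y = 0.
Proof.
by move=> yh; rewrite /pushforward big1 // => t _; rewrite (negPf (yh t)) mulr0.
Qed.

Lemma dot_pushforward_inj f f' : injective h ->
  dot (pushforward f) (pushforward f') = dot f f'.
Proof.
move=> h_inj; rewrite dot_pushforward; apply: eq_bigr => t _ /=.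
by rewrite pushforward_inj.
Qed.

End Pushforward.

Lemma card_ord_bij (A : finType) d : #|A| = d ->
  exists (f : 'I_d -> A) (g : A -> 'I_d), cancel f g /\ cancel g f.
Proof.
by move=> <-; exists enum_val, enum_rank; split; [apply: enum_valK|apply: enum_rankK].
Qed.

Section LabelledBasis.
Variables (R : realType) (d : nat) (Y : finType) (label : 'I_d -> Y) (idx : Y -> 'I_d).
Hypothesis labelK : cancel label idx.
Hypothesis idxK : cancel idx label.
Local Notation C := R[i].
Implicit Types (f g : Y -> C) (h : Y -> Y).

Definition colv f : 'cV[C]_d := \col_i f (label i).

Definition relabel_mx h : 'M[C]_d := \matrix_(i, j) (h (label i) == label j)%:R.

Lemma sum_label (F : Y -> C) : \sum_i F (label i) = \sum_y F y.
Proof. by rewrite [RHS](reindex label) //; exists idx => ? _. Qed.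

Lemma relabel_mx_colv h f : relabel_mx h *m colv f = colv (f \o h).
Proof.
apply/matrixP => i j; rewrite !mxE -[RHS]/(f _) -[RHS]sum_deltal -sum_label.
by apply: eq_bigr => k _; rewrite !mxE.
Qed.

Lemma relabel_mx_unitary h : involutive h -> unitary (relabel_mx h).
Proof.
move=> hK; apply: unitary_of_isometry; apply/matrixP => i j; rewrite !mxE.
under eq_bigr do rewrite !mxE conjc_nat (inv_eq hK) [h _ == _](inv_eq hK).
rewrite (sum_label (fun y => (y == h (label i))%:R * (y == h (label j))%:R)).
by rewrite sum_delta_sym (inj_eq (inv_inj hK)) (can_eq labelK).
Qed.

Section OrthonormalFamilies.
Variable K : finType.
Implicit Types u v w : K -> Y -> C.

Definition orthonormal u := forall s t, dot (u s) (u t) = (s == t)%:R.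

Definition family_mx u : 'M[C]_(d, #|K|) := \matrix_(i, j) u (enum_val j) (label i).

Lemma family_mx_gram u v : adjmx (family_mx u) *m family_mx v =
  \matrix_(i, j) dot (u (enum_val i)) (v (enum_val j)).
Proof.
apply/matrixP => i j; rewrite !mxE /dot -sum_label; apply: eq_bigr => k _.
by rewrite adjmxE !mxE.
Qed.

Lemma family_mx_isometry u : orthonormal u -> adjmx (family_mx u) *m family_mx u = 1%:M.
Proof.
move=> orth; rewrite family_mx_gram; apply/matrixP => i j.
by rewrite !mxE orth (inj_eq enum_val_inj).
Qed.

Lemma family_mx_colv u (f : K -> C) :
  family_mx u *m (\col_j f (enum_val j)) = colv (fun y => \sum_k f k * u k y).
Proof.
apply/matrixP => i j; rewrite !mxE (reindex _ (onW_bij _ (@enum_val_bij K))) /=.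
by apply: eq_bigr => k _; rewrite !mxE mulrC.
Qed.

Lemma exists_unitary_between v w : orthonormal v -> orthonormal w ->
  (forall s t, dot (v s) (w t) = 0) ->
  exists W : 'M[C]_d, unitary W /\ forall f : K -> C,
    W *m colv (fun y => \sum_k f k * w k y) = colv (fun y => \sum_k f k * v k y).
Proof.
move=> /family_mx_isometry v_iso /family_mx_isometry w_iso vw.
have orthogonal : adjmx (family_mx v) *m family_mx w = 0.
  by rewrite family_mx_gram; apply/matrixP => i j; rewrite !mxE vw.
exists (exchange_mx (family_mx v) (family_mx w)).
split=> [|f]; first exact: exchange_mx_unitary.
by rewrite -!family_mx_colv mulmxA exchange_mxr.
Qed.

End OrthonormalFamilies.
End LabelledBasis.

Lemma ler_sum_injective (R : numDomainType) (I J : finType) (h : I -> J) (P : pred J)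
    (F : J -> R) : injective h -> (forall j, 0 <= F j) ->
  \sum_(i | P (h i)) F (h i) <= \sum_(j | P j) F j.
Proof.
move=> h_inj F0.
rewrite [leRHS](bigID (fun j => j \in [set h i | i : I]%SET)) -[leLHS]addr0.
rewrite lerD ?sumr_ge0 //.
under [leRHS]eq_bigl do rewrite andbC.
by rewrite big_imset_cond // => i i' _ _; apply: h_inj.
Qed.

Section CopiesCircuit.
Variables (R : realType) (n : nat) (B : finType).
Local Notation C := R[i].
Local Notation N := (2 ^ n)%N.
Local Notation X := ('I_N * B)%type.
Variable phi : X -> C.

Definition copy (U : 'M[C]_N) (x : X) : C := \sum_q U x.1 q * phi (q, x.2).

Variables (T : nat) (O : finType).
Local Notation Z := {ffun 'I_T -> X}.

(* Besides the T copies, the ancilla holds one bit separating the states reached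
   during the run from the initial basis state and from the outcome states, and a
   register whose basis state [set o] records the outcome o. *)
Local Notation Anc := (Z * (bool * {set O}))%type.
Local Notation Y := ('I_N * Anc)%type.
Variables (a : nat) (dec : 'I_(2 ^ a) -> Anc) (enc : Anc -> 'I_(2 ^ a)).
Hypothesis decK : cancel dec enc.
Hypothesis encK : cancel enc dec.
Local Notation D := (N * 2 ^ a)%N.

Definition label (i : 'I_D) : Y := ((mxtens_unindex i).1, dec (mxtens_unindex i).2).

Definition label_inv (y : Y) : 'I_D := mxtens_index (y.1, enc y.2).

Lemma labelK : cancel label label_inv.
Proof.
by move=> i; rewrite /label_inv /label [X in (_, enc X)]/= decK; apply: mxtens_unindexK.
Qed.

Lemma label_invK : cancel label_inv label.
Proof. by move=> [q y]; rewrite /label /label_inv mxtens_indexK /= encK. Qed.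

Local Notation colv := (colv label).

Lemma oracle_colv (U : 'M[C]_N) (f : Y -> C) :
  (U *t (1%:M : 'M[C]_(2 ^ a))) *m colv f = colv (fun y => \sum_q U y.1 q * f (q, y.2)).
Proof.
pose kernel y y' := U y.1 y'.1 * (y.2 == y'.2)%:R * f y'.
apply/matrixP => i j; rewrite !mxE.
transitivity (\sum_k kernel (label i) (label k)).
  by apply: eq_bigr => k _; rewrite !mxE /kernel (can_eq decK).
rewrite (sum_label labelK label_invK (kernel (label i))).
transitivity (\sum_q \sum_r kernel (label i) (q, r)).
  by rewrite pair_bigA; apply: eq_bigr => -[].
apply: eq_bigr => q _; rewrite -[in RHS](sum_deltar (label i).2 (fun r => _ * f (q, r))).
by apply: eq_bigr => r _; rewrite /kernel mulrAC.
Qed.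

Definition start_label : Y := label (zero_idx n a).

Definition run_label (z : Z) : Y :=
  (start_label.1, (z, (~~ start_label.2.2.1, finset.set0))).

Definition outcome_label (o : O) : Y :=
  (start_label.1, (start_label.2.1, (start_label.2.2.1, [set o]%SET))).

Lemma run_label_inj : injective run_label.
Proof. by move=> z z' []. Qed.

Lemma outcome_label_inj : injective outcome_label.
Proof. by move=> o o' [] /finset.set1_inj. Qed.

Lemma run_label_neq y z : y.2.2.1 = start_label.2.2.1 -> y != run_label z.
Proof.
move=> yb; apply/eqP => y_run; move: yb.
by rewrite y_run /run_label; case: (start_label.2.2.1).
Qed.

Lemma pushforward_run (f : Z -> C) y : pushforward run_label f y =
  (y.1 == start_label.1)%:R * (y.2.2 == (~~ start_label.2.2.1, finset.set0))%:R * f y.2.1.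
Proof.
case: y => q [z r] /=; rewrite /pushforward -(sum_deltar z) mulr_sumr.
apply: eq_bigr => z' _; rewrite /run_label !xpair_eqE -!mulnb !natrM; ring.
Qed.

Definition overwrite (z : Z) (s : 'I_T) (q : 'I_N) : Z :=
  [ffun s' => if s' == s then (q, (z s).2) else z s'].

Definition swap (s : 'I_T) (y : Y) : Y := ((y.2.1 s).1, (overwrite y.2.1 s y.1, y.2.2)).

Definition swap_mx (t : nat) : 'M[C]_D :=
  if insub t is Some s then relabel_mx R label (swap s) else 1%:M.

Lemma overwriteK z s : overwrite z s (z s).1 = z.
Proof.
by apply/ffunP => s'; rewrite ffunE; case: eqP => [->|//]; rewrite -surjective_pairing.
Qed.

Lemma overwrite_overwrite z s q q' : overwrite (overwrite z s q) s q' = overwrite z s q'.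
Proof. by apply/ffunP => s'; rewrite !ffunE eqxx; case: eqP. Qed.

Lemma swap_involutive s : involutive (swap s).
Proof.
by move=> [q [z r]]; rewrite /swap /= ffunE eqxx overwrite_overwrite overwriteK.
Qed.

Lemma swap_mx_unitary t : unitary (swap_mx t).
Proof.
rewrite /swap_mx; case: insub => [s|]; last exact: unitary1.
exact/(relabel_mx_unitary R labelK label_invK)/swap_involutive.
Qed.

Lemma swap_mx_colv (s : 'I_T) (f : Y -> C) : swap_mx s *m colv f = colv (f \o swap s).
Proof. by rewrite /swap_mx valK; apply: (relabel_mx_colv labelK label_invK). Qed.

Definition queried (U : 'M[C]_N) (t : nat) (z : Z) : C :=
  \prod_(s < T) (if (s < t)%N then copy U (z s) else phi (z s)).

Lemma queriedT U : queried U T =1 tensor_power T (copy U).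
Proof. by move=> z; apply: eq_bigr => s _; rewrite ltn_ord. Qed.

Lemma queriedS (U : 'M[C]_N) (s : 'I_T) z q :
  \sum_q' U q q' * queried U s (overwrite z s q') = queried U s.+1 (overwrite z s q).
Proof.
rewrite /queried (bigD1 s) //= ltnSn ffunE eqxx mulr_suml; apply: eq_bigr => q' _.
rewrite (bigD1 s) //= ltnn ffunE eqxx -mulrA; congr (_ * (_ * _)).
apply: eq_bigr => s' s's; rewrite !ffunE (negPf s's) ltnS [(s' <= s)%N]leq_eqVlt.
by rewrite val_eqE (negPf s's).
Qed.

Lemma query_colv (U : 'M[C]_N) (s : 'I_T) :
  swap_mx s *m ((U *t (1%:M : 'M[C]_(2 ^ a))) *m
    (swap_mx s *m colv (pushforward run_label (queried U s)))) =
  colv (pushforward run_label (queried U s.+1)).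
Proof.
rewrite swap_mx_colv oracle_colv swap_mx_colv; congr colv.
apply/funext => -[q [z r]] /=; rewrite pushforward_run /=.
under eq_bigr do rewrite pushforward_run /= ffunE eqxx overwrite_overwrite mulrCA.
by rewrite -mulr_sumr queriedS overwriteK.
Qed.

Lemma exists_preparation : sqnorm phi = 1 -> exists W : 'M[C]_D, unitary W /\
  W *m delta_mx (zero_idx n a) 0 = colv (pushforward run_label (tensor_power T phi)).
Proof.
move=> phi1; pose v (_ : 'I_1) := pushforward run_label (tensor_power T phi).
pose w (_ : 'I_1) : Y -> C := ket R start_label.
have [||s t|W [uW /(_ (fun=> 1)) W_start]] := exists_unitary_between labelK label_invK
  (v := v) (w := w).
- move=> s t; rewrite !ord1 (dot_pushforward_inj _ _ run_label_inj) dotxx.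
  by rewrite sqnorm_tensor_power phi1 expr1n.
- by move=> s t; rewrite !ord1 dotxx sqnorm_ket.
- by rewrite -dot_conj dot_ketl /v pushforward_off ?conjc0 // => z; apply: run_label_neq.
exists W; split=> //; transitivity (W *m colv (fun y => \sum_(k < 1) 1 * w k y)).
  congr (W *m _); apply/matrixP => i j; rewrite !mxE big_ord1 mul1r ord1 andbT.
  by rewrite /w /ket (can_eq labelK).
by rewrite W_start; congr colv; apply/funext => y; rewrite big_ord1 mul1r.
Qed.

Variable w : O -> Z -> C.
Hypothesis w_povm : povm w.

Lemma exists_readout : exists W : 'M[C]_D, unitary W /\ forall f : Z -> C,
  W *m colv (pushforward run_label f) =
  colv (pushforward outcome_label (fun o => dot (w o) f)).
Proof.
pose v z := pushforward outcome_label (fun o => (w o z)^*).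
pose u z : Y -> C := ket R (run_label z).
have [||z z'|W [uW W_run]] := exists_unitary_between labelK label_invK (v := v) (w := u).
- move=> z z'; rewrite (dot_pushforward_inj _ _ outcome_label_inj) -w_povm.
  by apply: eq_bigr => o _; rewrite conjcK.
- by move=> z z'; rewrite dot_ketl /u /ket (inj_eq run_label_inj).
- rewrite -dot_conj dot_ketl /v pushforward_off ?conjc0 // => o.
  by rewrite eq_sym run_label_neq.
exists W; split=> // f; rewrite W_run; congr colv; apply/funext => y.
under eq_bigr do rewrite mulr_sumr.
rewrite exchange_big; apply: eq_bigr => o _ /=; rewrite mulr_suml.
by apply: eq_bigr => z _; rewrite mulrCA mulrA.
Qed.

Variable out : O -> 'M[C]_N.
Hypothesis out_unitary : forall o, unitary (out o).

Definition decode (i : 'I_D) : 'M[C]_N :=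
  if [pick o | (label i).2.2.2 == [set o]%SET] is Some o then out o else 1%:M.

Lemma decode_unitary i : unitary (decode i).
Proof. by rewrite /decode; case: pickP => // _; apply: unitary1. Qed.

Lemma decode_outcome o : decode (label_inv (outcome_label o)) = out o.
Proof.
rewrite /decode label_invK /=; case: pickP => [o' /eqP/finset.set1_inj -> //|/(_ o)].
by rewrite eqxx.
Qed.

Lemma exists_circuit : sqnorm phi = 1 -> exists A : query_alg R n,
  nqueries A = T /\ forall U eps,
  prob (born w (tensor_power T (copy U))) (fun o => qdist U (out o) <= eps)
    <= success_prob A U eps.
Proof.
move=> /exists_preparation[prep [prep_unitary prep_start]].
have [readout [readout_unitary readout_run]] := exists_readout.
pose after t := if (t < T)%N then swap_mx t else readout.
pose before t := if t is t'.+1 then swap_mx t' else prep.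
have gate_unitary t : unitary (after t *m before t).
  apply: unitaryM; first by rewrite /after; case: ifP => _ //; apply: swap_mx_unitary.
  by case: t => [|t] //; apply: swap_mx_unitary.
pose alg := QueryAlg T gate_unitary decode_unitary.
have runE U t : (t <= T)%N ->
    run_state alg U t = after t *m colv (pushforward run_label (queried U t)).
  elim: t => [_|t IH tT] /=; first by rewrite -mulmxA prep_start.
  rewrite (IH (ltnW tT)) -(query_colv U (Ordinal tT)) /= /after tT.
  by symmetry; apply: mulmxA.
exists alg; split=> // U eps.
have final o : final_state alg U (label_inv (outcome_label o)) 0 =
    dot (w o) (tensor_power T (copy U)).
  rewrite /final_state runE // /after ltnn readout_run mxE label_invK.
  rewrite (pushforward_inj _ _ outcome_label_inj); congr dot.
  exact/funext/queriedT.
apply: le_trans (ler_sum_injective (h := label_inv \o outcome_label) _ _ _).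
- rewrite /prob /born; under [leLHS]eq_bigr do rewrite -final.
  by under [leRHS]eq_bigl do rewrite /= decode_outcome.
- by move=> o o' /(can_inj label_invK)/outcome_label_inj.
- by move=> i; apply: sqr_ge0.
Qed.

End CopiesCircuit.

Lemma circuit_measures_copies (R : realType) (n b : nat) (B : finType)
    (phi : 'I_(2 ^ n) * B -> R[i]) (T : nat) (O : finType)
    (w : O -> {ffun 'I_T -> 'I_(2 ^ n) * B} -> R[i]) (out : O -> 'M[R[i]]_(2 ^ n)) :
  #|B| = (2 ^ b)%N -> sqnorm phi = 1 -> povm w -> (forall o, unitary (out o)) ->
  exists A : query_alg R n, nqueries A = T /\ forall U eps,
    prob (born w (tensor_power T (copy phi U))) (fun o => qdist U (out o) <= eps)
      <= success_prob A U eps.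
Proof.
move=> cardB phi1 w_povm out_unitary.
pose a := ((n + b) * T + #|O|.+1)%N.
have cardAnc : #|{: {ffun 'I_T -> 'I_(2 ^ n) * B} * (bool * {set O})}| = (2 ^ a)%N.
  rewrite !card_prod card_ffun card_prod !card_ord cardB card_bool.
  rewrite -expnD -expnM expnD expnS; congr (_ * (_ * _))%N.
  by rewrite -cardsT -powersetT card_powerset cardsT.
have [dec [enc [decK encK]]] := card_ord_bij cardAnc.
exact: (exists_circuit decK encK w_povm out_unitary phi1).
Qed.

(** * Adaptive sampling *)

Section FfunCat.
Variables (X : Type) (T1 T2 : nat).

Definition ffcat (z : {ffun 'I_T1 -> X} * {ffun 'I_T2 -> X}) : {ffun 'I_(T1 + T2) -> X} :=
  [ffun i => match split i with inl j => z.1 j | inr j => z.2 j end].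

Definition ffsplit (z : {ffun 'I_(T1 + T2) -> X}) :=
  ([ffun i => z (lshift T2 i)], [ffun i => z (rshift T1 i)]).

Lemma ffcat_lshift z i : ffcat z (lshift T2 i) = z.1 i.
Proof. by rewrite ffunE -[lshift _ i]/(unsplit (inl i)) unsplitK. Qed.

Lemma ffcat_rshift z i : ffcat z (rshift T1 i) = z.2 i.
Proof. by rewrite ffunE -[rshift _ i]/(unsplit (inr i)) unsplitK. Qed.

Lemma ffcatK : cancel ffcat ffsplit.
Proof.
move=> [z1 z2]; congr (_, _); apply/ffunP => i; rewrite ffunE.
  by rewrite ffcat_lshift.
by rewrite ffcat_rshift.
Qed.

Lemma ffsplitK : cancel ffsplit ffcat.
Proof.
move=> z; apply/ffunP => i; rewrite ffunE -[in RHS](splitK i).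
by case: (split i) => j; rewrite ffunE.
Qed.

End FfunCat.

Section PovmChain.
Variables (R : realType) (I O1 O2 : finType) (T1 T2 : nat).
Local Notation C := R[i].
Variables (w1 : O1 -> {ffun 'I_T1 -> I} -> C) (w2 : O1 -> O2 -> {ffun 'I_T2 -> I} -> C).

Definition povm_chain (o : O1 * O2) (z : {ffun 'I_(T1 + T2) -> I}) : C :=
  w1 o.1 (ffsplit z).1 * w2 o.1 o.2 (ffsplit z).2.

Lemma povm_chainP : povm w1 -> (forall o1, povm (w2 o1)) -> povm povm_chain.
Proof.
move=> w1_povm w2_povm z z'; rewrite /povm_chain -(can_eq (@ffsplitK I T1 T2)).
case: (ffsplit z) (ffsplit z') => [z1 z2] [z1' z2'].
transitivity (\sum_o1 w1 o1 z1 * (w1 o1 z1')^* *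
    \sum_o2 w2 o1 o2 z2 * (w2 o1 o2 z2')^*).
  under [RHS]eq_bigr do rewrite mulr_sumr.
  by rewrite pair_bigA; apply: eq_bigr => -[o1 o2] _ /=; rewrite conjcM; ring.
under eq_bigr do rewrite w2_povm.
by rewrite -mulr_suml w1_povm -natrM mulnb xpair_eqE.
Qed.

Lemma tensor_power_ffcat (psi : I -> C) z :
  tensor_power (T1 + T2) psi (ffcat z) =
  tensor_power T1 psi z.1 * tensor_power T2 psi z.2.
Proof.
rewrite /tensor_power big_split_ord; congr (_ * _); apply: eq_bigr => t _.
  by rewrite ffcat_lshift.
by rewrite ffcat_rshift.
Qed.

Lemma born_povm_chain (psi : I -> C) :
  born povm_chain (tensor_power (T1 + T2) psi) =1
  chain (born w1 (tensor_power T1 psi)) (fun o1 => born (w2 o1) (tensor_power T2 psi)).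
Proof.
move=> [o1 o2]; rewrite /chain /born -abs2M; congr abs2; rewrite /dot.
rewrite (reindex (@ffcat I T1 T2)); last first.
  by exists (@ffsplit I T1 T2) => ? _; rewrite ?ffcatK ?ffsplitK.
rewrite mulr_suml; under [RHS]eq_bigr do rewrite mulr_sumr.
rewrite pair_bigA; apply: eq_bigr => z _ /=.
by rewrite tensor_power_ffcat /povm_chain ffcatK conjcM; ring.
Qed.

End PovmChain.

Section Samplable.
Variables (R : realType) (I : finType).
Local Notation C := R[i].

Definition samplable (T : nat) (O : finType) (P : (I -> C) -> O -> R) :=
  exists2 w : O -> {ffun 'I_T -> I} -> C, povm w &
    forall psi, P psi =1 born w (tensor_power T psi).

Lemma povm_ket : povm (@ket R I).
Proof. by move=> x x'; under eq_bigr do rewrite conjc_nat; rewrite sum_deltal eq_sym. Qed.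

Lemma samplable_iid (O : finType) (m : nat) (w : O -> I -> C) :
  povm w -> samplable m (fun psi => iid (born w psi) (m := m)).
Proof.
move=> w_povm; exists (povm_power w); first exact: povm_powerP.
by move=> psi o; rewrite born_povm_power.
Qed.

Lemma samplable_basis (m : nat) : samplable m (fun psi => iid (abs2 \o psi) (m := m)).
Proof.
have [w w_povm wE] := samplable_iid m povm_ket.
exists w => // psi o; rewrite -wE; apply: eq_bigr => k _.
by rewrite /born dot_ketl.
Qed.

Lemma samplable_chain (O1 O2 : finType) (T1 T2 : nat)
    (P1 : (I -> C) -> O1 -> R) (P2 : O1 -> (I -> C) -> O2 -> R) :
  samplable T1 P1 -> (forall o1, samplable T2 (P2 o1)) ->
  samplable (T1 + T2) (fun psi => chain (P1 psi) (P2^~ psi)).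
Proof.
move=> [w1 w1_povm P1E] P2_samplable.
have /choice[w2 w2P] : forall o1, exists w2, povm w2 /\
    forall psi, P2 o1 psi =1 born w2 (tensor_power T2 psi).
  by move=> o1; have [w2 ? ?] := P2_samplable o1; exists w2.
exists (povm_chain w1 w2); first by apply: povm_chainP => // o1; case: (w2P o1).
by move=> psi [o1 o2]; rewrite born_povm_chain /chain P1E (w2P o1).2.
Qed.

End Samplable.

Lemma samplable_circuit (R : realType) (n b : nat) (B I O : finType)
    (phi : 'I_(2 ^ n) * B -> R[i]) (E : I -> 'I_(2 ^ n) * B -> R[i]) (T : nat)
    (P : (I -> R[i]) -> O -> R) (out : O -> 'M[R[i]]_(2 ^ n)) :
  #|B| = (2 ^ b)%N -> sqnorm phi = 1 -> povm E -> samplable T P ->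
  (forall o, unitary (out o)) ->
  exists A : query_alg R n, nqueries A = T /\ forall U eps,
    prob (P (fun i => dot (E i) (copy phi U))) (fun o => qdist U (out o) <= eps)
      <= success_prob A U eps.
Proof.
move=> cardB phi1 E_povm [w w_povm PE] out_unitary.
have [A [AT A_success]] := circuit_measures_copies cardB phi1
  (povm_compP (povm_powerP (m := T) E_povm) w_povm) out_unitary.
exists A; split=> // U eps; apply: le_trans (A_success U eps).
rewrite le_eqVlt; apply/orP; left; apply/eqP; apply: eq_bigr => o _.
rewrite PE /born dot_povm_comp; congr (abs2 (dot _ _)); apply/funext => z.
by rewrite dot_povm_power.
Qed.

(** * Bit vectors and juntas *)

Local Notation bitvec n := {ffun 'I_n -> bool}.

Section BitVectors.
Variable n : nat.
Implicit Types (x y b : bitvec n) (i : 'I_n).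

Definition bits_of (x : 'I_(2 ^ n)) : bitvec n := [ffun i => qbit x i].

Definition of_bits b : 'I_(2 ^ n) := ordmod n (\sum_j b j * 2 ^ j).

Definition zerov : bitvec n := [ffun=> false].

Definition unitv i : bitvec n := [ffun j => j == i].

Definition bxor x y : bitvec n := [ffun i => x i (+) y i].

Lemma bits_ofK : cancel bits_of of_bits.
Proof.
suff binary_expansion k r : (r < 2 ^ k)%N ->
    (\sum_(j < k) odd (r %/ 2 ^ j) * 2 ^ j)%N = r.
  move=> x; apply: val_inj => /=; under eq_bigr do rewrite ffunE.
  by rewrite binary_expansion // modn_small.
elim: k r => [|k IH] r; first by rewrite ltnS leqn0 big_ord0 => /eqP ->.
move=> r_lt; rewrite big_ord_recl /= divn1 muln1.
under eq_bigr => j _ do rewrite /bump /= add1n expnS divnMA mulnCA.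
rewrite -big_distrr /= IH ?divn2 ?mul2n ?odd_double_half //.
by rewrite -divn2 ltn_divLR // mulnC -expnS.
Qed.

Lemma of_bitsK : cancel of_bits bits_of.
Proof.
apply/bij_can_sym/bits_ofK/inj_card_bij; first exact: can_inj bits_ofK.
by rewrite card_ffun card_bool !card_ord.
Qed.

Lemma qbit_of_bits b i : qbit (of_bits b) i = b i.
Proof. by rewrite -[in RHS](of_bitsK b) ffunE. Qed.

Lemma sum_of_bits (A : nmodType) (F : 'I_(2 ^ n) -> A) :
  \sum_x F x = \sum_b F (of_bits b).
Proof.
rewrite (reindex of_bits) //.
by exists bits_of => b _; [apply: of_bitsK | apply: bits_ofK].
Qed.

Lemma bxorK y : involutive (bxor^~ y).
Proof. by move=> x; apply/ffunP => i; rewrite !ffunE addbK. Qed.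

Lemma bxor_eq x y b : (x == bxor y b) = (bxor x y == b).
Proof.
apply/eqP/eqP => [->|<-]; apply/ffunP => i; rewrite !ffunE; first by rewrite addbAC addbb.
by rewrite addbCA addbb addbF.
Qed.

Lemma bxor_injl y : injective (bxor^~ y).
Proof. exact: inv_inj (bxorK y). Qed.

Lemma bxorAC x y b : bxor (bxor x y) b = bxor (bxor x b) y.
Proof. by apply/ffunP => i; rewrite !ffunE addbAC. Qed.

End BitVectors.

Arguments zerov {n}.

Section Entries.
Variables (R : realType) (n : nat).
Local Notation C := R[i].
Implicit Types (A B : 'M[C]_(2 ^ n)) (x y : bitvec n).

Definition entry A x y : C := A (of_bits x) (of_bits y).

Lemma entry_inj A B : (forall x y, entry A x y = entry B x y) -> A = B.
Proof.
by move=> AB; apply/matrixP => x y; rewrite -(bits_ofK x) -(bits_ofK y); apply: AB.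
Qed.

Lemma entryM A B x y : entry (A *m B) x y = \sum_z entry A x z * entry B z y.
Proof. by rewrite /entry mxE sum_of_bits. Qed.

Lemma entry_adj A x y : entry (adjmx A) x y = (entry A y x)^*.
Proof. by rewrite /entry adjmxE. Qed.

Lemma entry1 x y : entry 1%:M x y = (x == y)%:R.
Proof. by rewrite /entry mxE (can_eq (@of_bitsK n)). Qed.

End Entries.

Section Juntas.
Variables (R : realType) (n : nat) (S : {set 'I_n}).
Local Notation C := R[i].
Local Notation k := #|S|.
Implicit Types (x y z : bitvec n) (A B V : 'M[C]_(2 ^ k)).

Record junta_on (U : 'M[C]_(2 ^ n)) : Prop := JuntaOn {
  junta_on_unitary : unitary U;
  junta_on_eq0 : forall x y i, i \notin S -> x i != y i -> entry U x y = 0;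
  junta_on_shift : forall i x y, i \notin S ->
    entry U (bxor x (unitv i)) (bxor y (unitv i)) = entry U x y
}.

Definition bit_restr x : bitvec k := [ffun j => x (enum_val j)].

Definition agree_off x y := [forall i in ~: S, x i == y i].

Definition bit_extend y (b : bitvec k) : bitvec n :=
  [ffun i => if [pick j | enum_val j == i] is Some j then b j else y i].

Lemma agree_offP x y : reflect (forall i, i \notin S -> x i = y i) (agree_off x y).
Proof.
by apply: (iffP forall_inP) => xy i; [move=> iS; apply/eqP|rewrite inE => /xy ->];
  rewrite ?xy ?inE.
Qed.

Lemma restr_idx_of_bits x : restr_idx k S (of_bits x) = of_bits (bit_restr x).
Proof.
rewrite /restr_idx [RHS]/of_bits; congr ordmod.
rewrite big_enum /= big_enum_val /=; apply: eq_bigr => j _.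
rewrite qbit_of_bits ffunE; congr (_ * 2 ^ _)%N.
by rewrite (enum_val_nth (enum_val j)) index_uniq ?enum_uniq // -cardE.
Qed.

Lemma junta_entry V x y : entry (junta_mx S V) x y =
  if agree_off x y then entry V (bit_restr x) (bit_restr y) else 0.
Proof.
rewrite /entry mxE !restr_idx_of_bits; congr (if _ then _ else _).
by apply: eq_forallb => i; rewrite !qbit_of_bits.
Qed.

Lemma bit_restr_extend y b : bit_restr (bit_extend y b) = b.
Proof.
apply/ffunP => j; rewrite !ffunE; case: pickP => [l /eqP/enum_val_inj -> //|/(_ j)].
by rewrite eqxx.
Qed.

Lemma agree_off_extend y b : agree_off y (bit_extend y b).
Proof.
apply/agree_offP => i iS; rewrite ffunE; case: pickP => [j /eqP ji|//].
by rewrite -ji enum_valP in iS.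
Qed.

Lemma bit_extend_restr y x : agree_off y x -> bit_extend y (bit_restr x) = x.
Proof.
move=> /agree_offP yx; apply/ffunP => i; rewrite ffunE.
case: pickP => [j /eqP <-|no_j]; first by rewrite ffunE.
apply: yx; apply/negP => iS.
by have := no_j (enum_rank_in iS i); rewrite enum_rankK_in // eqxx.
Qed.

Lemma sum_agree_off y (F : bitvec k -> C) :
  \sum_(x | agree_off y x) F (bit_restr x) = \sum_b F b.
Proof.
rewrite (reindex_onto (bit_extend y) bit_restr) => [|x]; last exact: bit_extend_restr.
apply: eq_big => b; first by rewrite agree_off_extend bit_restr_extend eqxx.
by rewrite bit_restr_extend.
Qed.

Lemma agree_off_sym x y : agree_off x y = agree_off y x.
Proof. by apply/agree_offP/agree_offP => xy i iS; rewrite xy. Qed.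

Lemma agree_off_trans x y z : agree_off x y -> agree_off x z = agree_off y z.
Proof.
by move=> /agree_offP xy; apply/agree_offP/agree_offP => xz i iS; rewrite -xz // xy.
Qed.

Lemma agree_off_bit_restr x y : agree_off x y -> (bit_restr x == bit_restr y) = (x == y).
Proof.
move=> xy; apply/eqP/eqP => [restr_xy|-> //].
by rewrite -[RHS](bit_extend_restr xy) -restr_xy bit_extend_restr //; apply/agree_offP.
Qed.

Lemma junta_mx1 : junta_mx S (1%:M : 'M[C]_(2 ^ k)) = 1%:M.
Proof.
apply: entry_inj => x y; rewrite junta_entry !entry1.
case: ifPn => [/agree_off_bit_restr -> //|xy]; case: eqP xy => // ->.
by case/negP; apply/agree_offP.
Qed.

Lemma adj_junta_mx V : adjmx (junta_mx S V) = junta_mx S (adjmx V).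
Proof.
apply: entry_inj => x y; rewrite entry_adj !junta_entry agree_off_sym entry_adj.
by case: ifP => // _; rewrite conjc0.
Qed.

Lemma junta_mxM A B : junta_mx S A *m junta_mx S B = junta_mx S (A *m B).
Proof.
apply: entry_inj => x y; rewrite entryM junta_entry entryM.
transitivity (\sum_(z | agree_off x z) if agree_off x y then
    entry A (bit_restr x) (bit_restr z) * entry B (bit_restr z) (bit_restr y) else 0).
  rewrite [RHS]big_mkcond; apply: eq_bigr => z _; rewrite !junta_entry.
  case: ifP => [/agree_off_trans <-|_]; last by rewrite mul0r.
  by case: ifP => // _; rewrite mulr0.
case: ifP => _; last by rewrite big1.
exact: (sum_agree_off x (fun b => entry A (bit_restr x) b * entry B b (bit_restr y))).
Qed.

Lemma junta_mx_unitary V : unitary V -> unitary (junta_mx S V).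
Proof.
by move=> [VV _]; apply: unitary_of_isometry; rewrite adj_junta_mx junta_mxM VV junta_mx1.
Qed.

Lemma junta_mx_junta_on V : unitary V -> junta_on (junta_mx S V).
Proof.
move=> uV; split; first exact: junta_mx_unitary.
  move=> x y i iS xy; rewrite junta_entry ifN //; apply: contra xy.
  by move/agree_offP/(_ i iS) ->.
move=> i x y iS; have restr_shift z : bit_restr (bxor z (unitv i)) = bit_restr z.
  apply/ffunP => j; rewrite !ffunE [_ == i](_ : _ = false) ?addbF //.
  by apply: contraNF iS => /eqP <-; apply: enum_valP.
rewrite !junta_entry !restr_shift; congr (if _ then _ else _).
by apply: eq_forallb => j; rewrite !ffunE (inj_eq (can_inj (addbK _))).
Qed.

End Juntas.

Lemma is_junta_junta_on (R : realType) n k (U : 'M[R[i]]_(2 ^ n)) : is_junta k U ->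
  exists S : {set 'I_n}, #|S| = k /\ junta_on S U.
Proof.
by case=> S [<- [V [uV ->]]]; exists S; split=> //; apply: junta_mx_junta_on.
Qed.

(** * The probe state and its coordinates *)

Section PauliBasis.
Variables (R : realType) (n : nat).
Local Notation C := R[i].
Local Notation N := (2 ^ n)%N.
Local Notation Bv := (bitvec n).
Implicit Types (p r y : Bv).

Definition chi r y : R := \prod_i (-1) ^+ (r i && y i).

Lemma chi_orthogonal y y' : \sum_r chi r y * chi r y' = N%:R * (y == y')%:R.
Proof.
pose g (i : 'I_n) (b : bool) : R := (-1) ^+ (b && y i) * (-1) ^+ (b && y' i).
transitivity (\prod_i \sum_b g i b).
  by rewrite bigA_distr_bigA; apply: eq_bigr => r _; rewrite -big_split.
have sum_g i : \sum_b g i b = 2 * (y i == y' i)%:R.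
  by rewrite big_bool /g; case: (y i); case: (y' i) => /=; ring.
under eq_bigr do rewrite sum_g.
have [->|/eqP/ffunP/existsNP[i /eqP/negPf yi]] := eqVneq y y'.
  by under eq_bigr do rewrite eqxx mulr1; rewrite prodr_const card_ord mulr1 natrX.
by rewrite (bigD1 i) //= yi !mulr0 mul0r.
Qed.

Lemma chi_flip r y i : r i -> chi r (bxor y (unitv i)) = - chi r y.
Proof.
move=> ri; rewrite /chi (bigD1 i) //= [in RHS](bigD1 i) //= !ffunE eqxx ri addbT -mulNr.
congr (_ * _); first by case: (y i); rewrite /= ?opprK.
by apply: eq_bigr => j /negPf ji; rewrite !ffunE ji addbF.
Qed.

Definition inv_sqrt_dim : R := (Num.sqrt N%:R)^-1.

Lemma natr_dim_gt0 : 0 < N%:R :> R.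
Proof. by rewrite ltr0n expn_gt0. Qed.

Lemma sqr_inv_sqrt_dim : inv_sqrt_dim ^+ 2 = N%:R^-1.
Proof. by rewrite exprVn sqr_sqrtr // ltW // natr_dim_gt0. Qed.

Definition comp_basis (pr : Bv * Bv) (x : 'I_N * Bv) : C := ((bits_of x.1, x.2) == pr)%:R.

(* The vectors (X^p Z^r (x) I) applied to the maximally entangled state. *)
Definition pauli_basis (pr : Bv * Bv) (x : 'I_N * Bv) : C :=
  (bits_of x.1 == bxor x.2 pr.1)%:R * (chi pr.2 x.2 * inv_sqrt_dim)%:C.

Lemma comp_basis_povm : povm comp_basis.
Proof.
move=> [q y] [q' y']; rewrite /comp_basis /=; under eq_bigr do rewrite conjc_nat.
by rewrite sum_deltal eq_sym !xpair_eqE (can_eq (@bits_ofK n)).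
Qed.

Lemma pauli_basis_povm : povm pauli_basis.
Proof.
move=> [q y] [q' y']; rewrite /pauli_basis /=.
transitivity (\sum_p (bxor (bits_of q) y == p)%:R * ((bxor (bits_of q') y' == p)%:R *
    (inv_sqrt_dim ^+ 2 * \sum_r chi r y * chi r y')%:C)).
  rewrite mulr_sumr rmorph_sum; under [RHS]eq_bigr do rewrite !mulr_sumr.
  rewrite pair_bigA; apply: eq_bigr => -[p r] _ /=.
  rewrite conjcM conjc_nat conjc_real !bxor_eq expr2 !(rmorphM (real_complex R)) /=; ring.
rewrite sum_deltal chi_orthogonal sqr_inv_sqrt_dim mulKf ?gt_eqF ?natr_dim_gt0 //.
rewrite (rmorph_nat (real_complex R)) -natrM mulnb xpair_eqE andbC.
have [<-|] := eqVneq y y'; last by rewrite andbF.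
by rewrite !andbT (inj_eq (@bxor_injl n y)) (can_eq (@bits_ofK n)) eq_sym.
Qed.

Definition branch_basis (c : bool) := if c then pauli_basis else comp_basis.

Lemma branch_basis_povm c : povm (branch_basis c).
Proof. by case: c; [apply: pauli_basis_povm | apply: comp_basis_povm]. Qed.

(* Up to its weight, branch [false] is U|0> (next to a register in state 0) and branch
   [true] is the Choi state of U.  The total squared norm 1/2 leaves room for two copies,
   and the Choi branch is light so that a sampled outcome is usually in branch [false]. *)
Definition branch_state (U : 'M[C]_N) (c : bool) (x : 'I_N * Bv) : C :=
  if c then (10^-1 * inv_sqrt_dim)%:C * U x.1 (of_bits x.2)
  else (7 / 10)%:C * (U x.1 (of_bits zerov) * (x.2 == zerov)%:R).

Definition coord (U : 'M[C]_N) (j : bool * (Bv * Bv)) : C :=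
  dot (branch_basis j.1 j.2) (branch_state U j.1).

Lemma coord_comp U p r :
  coord U (false, (p, r)) = (7 / 10)%:C * (entry U p zerov * (r == zerov)%:R).
Proof.
rewrite /coord /dot /comp_basis /=.
rewrite -(pair_bigA _ (fun q y => ((bits_of q, y) == (p, r))%:R^* *
  ((7 / 10)%:C * (U q (of_bits zerov) * (y == zerov)%:R)))) sum_of_bits /=.
rewrite -(sum_delta_sym p (fun b => (7 / 10)%:C * (entry U b zerov * (r == zerov)%:R))).
apply: eq_bigr => b _.
rewrite -(sum_delta_sym r (fun y => _ * (_ * (y == _)%:R))) mulr_sumr.
by apply: eq_bigr => y _; rewrite conjc_nat xpair_eqE of_bitsK -mulnb natrM -mulrA.
Qed.

Lemma coord_pauli U p r : coord U (true, (p, r)) =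
  (10^-1 / N%:R)%:C * \sum_y (chi r y)%:C * entry U (bxor y p) y.
Proof.
rewrite /coord /dot /pauli_basis /= -(pair_bigA _ (fun q y =>
  ((bits_of q == bxor y p)%:R * (chi r y * inv_sqrt_dim)%:C)^* *
  ((10^-1 * inv_sqrt_dim)%:C * U q (of_bits y)))) sum_of_bits exchange_big mulr_sumr /=.
apply: eq_bigr => y _; rewrite -sqr_inv_sqrt_dim.
rewrite -(sum_delta_sym (bxor y p) (fun b => (chi r y)%:C * entry U b y)) mulr_sumr.
apply: eq_bigr => b _; rewrite conjcM conjc_nat conjc_real of_bitsK /entry.
by rewrite !(rmorphM (real_complex R)) /=; ring.
Qed.

Lemma coord_lin U W (r k : C) j :
  coord (r *: U - k *: W) j = r * coord U j - k * coord W j.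
Proof.
rewrite /coord /dot !mulr_sumr -sumrB; apply: eq_bigr => x _.
by rewrite /branch_state; case: j.1; rewrite !mxE; ring.
Qed.

Lemma sqnorm_coord_branch U c :
  \sum_pr abs2 (coord U (c, pr)) = sqnorm (branch_state U c).
Proof. exact: sqnorm_povm (@branch_basis_povm c). Qed.

Lemma sqnorm_coord_comp U : unitary U -> \sum_pr abs2 (coord U (false, pr)) = 49 / 100.
Proof.
move=> uU; rewrite sqnorm_coord_branch /sqnorm /branch_state.
transitivity (49 / 100 * \sum_q abs2 (U q (of_bits zerov)) : R); last first.
  by rewrite -/(sqnorm (U^~ _)) sqnorm_unitary_col ?mulr1.
rewrite -(pair_bigA _ (fun q y => abs2 (_ * (U q _ * (y == zerov)%:R)))) mulr_sumr /=.
apply: eq_bigr => q _.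
rewrite -(sum_delta_sym (@zerov n) (fun=> 49 / 100 * abs2 (U q (of_bits zerov)))).
by apply: eq_bigr => y _; rewrite !abs2M abs2_real abs2_bool; field.
Qed.

Lemma sqnorm_coord_pauli U :
  \sum_pr abs2 (coord U (true, pr)) = (100 * N%:R)^-1 * sqnorm (entries U).
Proof.
rewrite sqnorm_coord_branch mulr_sumr /sqnorm.
rewrite -(pair_bigA _ (fun q q' => (100 * N%:R)^-1 * abs2 (U q q'))) /=.
under [RHS]eq_bigr do rewrite sum_of_bits.
rewrite pair_bigA; apply: eq_bigr => -[x y] _ /=.
rewrite /branch_state /= abs2M abs2_real exprMn sqr_inv_sqrt_dim; congr (_ * _).
by field; rewrite gt_eqF ?natr_dim_gt0.
Qed.

Lemma sqnorm_coord U : unitary U -> sqnorm (coord U) = 1 / 2.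
Proof.
move=> uU; rewrite /sqnorm sum_bool_prod sqnorm_coord_comp // sqnorm_coord_pauli.
rewrite sqnorm_unitary //.
by rewrite invfM mulfVK ?gt_eqF ?natr_dim_gt0 //; field.
Qed.

End PauliBasis.

Section Probe.
Variables (R : realType) (n : nat).
Local Notation C := R[i].
Local Notation N := (2 ^ n)%N.
Local Notation Bv := (bitvec n).
Local Notation J := (bool * (Bv * Bv))%type.
Local Notation X := ('I_N * (bool * (bool * Bv)))%type.

Definition doubled (T : finType) (a : T -> C) : bool * T -> C := fun i => a i.2.

Lemma sum_doubled (V : nmodType) (T : finType) (F : T -> V) :
  \sum_(i : bool * T) F i.2 = \sum_j F j + \sum_j F j.
Proof. exact: sum_bool_prod. Qed.

Lemma sqnorm_doubled (T : finType) (a : T -> C) : sqnorm (doubled a) = 2 * sqnorm a.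
Proof. by rewrite mulrDl !mul1r -sum_doubled. Qed.

(* The register holds a copy bit, a branch bit and the input of U in the Choi state;
   the copy bit is untouched, so that every branch is present twice. *)
Definition probe (x : X) : C := branch_state 1%:M x.2.2.1 (x.1, x.2.2.2).

Definition probe_basis (i : bool * J) (x : X) : C :=
  ((i.1, i.2.1) == (x.2.1, x.2.2.1))%:R * branch_basis R i.2.1 i.2.2 (x.1, x.2.2.2).

Lemma probe_basis_povm : povm probe_basis.
Proof.
move=> [q [d [c y]]] [q' [d' [c' y']]]; rewrite /probe_basis /=.
transitivity (\sum_(dc : bool * bool) (dc == (d, c))%:R * ((dc == (d', c'))%:R *
    \sum_pr branch_basis R dc.2 pr (q, y) * (branch_basis R dc.2 pr (q', y'))^*)).
  under [RHS]eq_bigr do rewrite !mulr_sumr.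
  rewrite pair_bigA (reindex (fun i : bool * J => ((i.1, i.2.1), i.2.2))) /=.
    by apply: eq_bigr => -[e [b pr]] _; rewrite conjcM conjc_nat; ring.
  by exists (fun i => (i.1.1, (i.1.2, i.2))) => [[? []]|[[]]].
rewrite sum_delta_sym branch_basis_povm -natrM mulnb !xpair_eqE.
by rewrite andbCA -andbA.
Qed.

Lemma dot_probe_basis (psi : X -> C) i : dot (probe_basis i) psi =
  dot (branch_basis R i.2.1 i.2.2) (fun z => psi (z.1, (i.1, (i.2.1, z.2)))).
Proof.
case: i => d [c pr]; rewrite /dot /probe_basis /=.
rewrite (reindex (fun x : (bool * bool) * ('I_N * Bv) =>
  (x.2.1, (x.1.1, (x.1.2, x.2.2))))) /=; last first.
  by exists (fun x => ((x.2.1, x.2.2.1), (x.1, x.2.2.2))) => [[[] ? ? []]|[? [? []]]].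
rewrite -(sum_deltal (d, c) (fun dc => \sum_z (branch_basis R c pr z)^* *
  psi (z.1, (dc.1, (dc.2, z.2))))).
under [RHS]eq_bigr do rewrite mulr_sumr.
rewrite pair_bigA; apply: eq_bigr => -[[d' c'] [q y]] _.
by rewrite conjcM conjc_nat mulrA.
Qed.

Lemma copy_probe U q d c y : copy probe U (q, (d, (c, y))) = branch_state U c (q, y).
Proof.
rewrite /copy /probe /branch_state /=; case: c.
  rewrite -(sum_deltar (of_bits y) (U q)) mulr_sumr; apply: eq_bigr => q' _.
  by rewrite mxE [q' == _]eq_sym mulrCA.
rewrite -(sum_deltar (of_bits zerov) (U q)) mulr_suml mulr_sumr; apply: eq_bigr => q' _.
by rewrite mxE [q' == _]eq_sym; ring.
Qed.

Lemma dot_probe_basis_copy U :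
  (fun i => dot (probe_basis i) (copy probe U)) = doubled (coord U).
Proof.
apply/funext => i; rewrite dot_probe_basis; apply: eq_bigr => -[q y] _.
by rewrite copy_probe.
Qed.

Lemma sqnorm_doubled_coord (U : 'M[C]_N) : unitary U -> sqnorm (doubled (coord U)) = 1.
Proof. by move=> uU; rewrite sqnorm_doubled sqnorm_coord //; field. Qed.

Lemma sqnorm_probe : sqnorm probe = 1.
Proof.
rewrite -(sqnorm_povm _ probe_basis_povm) -(sqnorm_doubled_coord (unitary1 R N)).
rewrite -dot_probe_basis_copy; apply: eq_bigr => i _; congr (abs2 (dot _ _)).
by apply/funext => -[q [d [c y]]]; rewrite copy_probe.
Qed.

Definition coord_support (j : J) : {set 'I_n} := [set i | j.2.1 i || j.2.2 i]%SET.

Lemma junta_coord_support S (U : 'M[C]_N) j :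
  junta_on S U -> coord U j != 0 -> coord_support j \subset S.
Proof.
move=> [_ U_eq0 U_shift]; case: j => c [p r]; apply: contra_neqT => /subsetPn[l].
rewrite inE /=; case: c => pr_l lS; last first.
  rewrite coord_comp; have [r0|_] := eqVneq r zerov; last by rewrite !mulr0.
  by rewrite (U_eq0 _ _ l) ?mul0r ?mulr0 //; move: pr_l; rewrite r0 !ffunE orbF => ->.
rewrite coord_pauli; apply/eqP; rewrite mulf_eq0; apply/orP; right; apply/eqP.
have [p_l|np_l] := boolP (p l).
  rewrite big1 // => y _; rewrite (U_eq0 _ _ l) ?mulr0 //.
  by rewrite ffunE p_l; case: (y l).
have r_l : r l by move: pr_l; rewrite (negPf np_l).
set s := \sum_y _; suff : s = - s.
  by move/eqP; rewrite -addr_eq0 -mulr2n mulrn_eq0 => /= /eqP.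
rewrite {1}/s (reindex_inj (@bxor_injl n (unitv l))) /= -sumrN; apply: eq_bigr => y _.
by rewrite chi_flip // rmorphN mulNr bxorAC U_shift.
Qed.

End Probe.

(** * Learning the relevant set *)

Section SupportSampling.
Variables (R : realType) (n m : nat) (I : finType).
Variables (p : I -> R) (supp : I -> {set 'I_n}) (S : {set 'I_n}).
Hypothesis p_distr : distribution p.
Hypothesis p_supp : forall i, p i != 0 -> supp i \subset S.
Implicit Type o : {ffun 'I_m -> I}.

Definition seen o : {set 'I_n} := (\bigcup_k supp (o k))%SET.

Definition missed (S' : {set 'I_n}) : R := prob p (fun i => ~~ (supp i \subset S')).

Lemma seen_subset o : iid p o != 0 -> seen o \subset S.
Proof.
move=> iid_o; apply/bigcupsP => k _; apply: p_supp.
by apply: contraNneq iid_o => pk0; rewrite /iid (bigD1 k) //= pk0 mul0r.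
Qed.

Let hit j := prob p (fun i => j \in supp i).

Let hit_itv j : 0 <= hit j <= 1.
Proof.
case: p_distr => p0 p1; rewrite sumr_ge0 // -p1 [leRHS](bigID (fun i => j \in supp i)) /=.
by rewrite lerDl sumr_ge0.
Qed.

Lemma missed_le_sum S' : missed S' <= \sum_(j in S) hit j * (j \notin S')%:R.
Proof.
under eq_bigr do rewrite mulr_suml.
rewrite (exchange_big_dep xpredT) //= /missed /prob big_mkcond ler_sum // => i _ /=.
have term_ge0 j : 0 <= p i * (j \notin S')%:R by rewrite mulr_ge0 ?(proj1 p_distr).
case: ifPn => [/subsetPn[j ji jS']|_]; last by rewrite sumr_ge0.
have [->|pi] := eqVneq (p i) 0; first by rewrite sumr_ge0 // => l _; rewrite mul0r.
rewrite (bigD1 j) /=; last by rewrite ji (fintype.subsetP (p_supp pi)).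
by rewrite jS' mulr1 lerDl sumr_ge0.
Qed.

Hypothesis m_gt0 : (0 < m)%N.

Lemma mean_missed_le : \sum_o iid p o * missed (seen o) <= #|S|%:R / m%:R.
Proof.
have [iid0 _] := iid_distribution m p_distr.
apply: (@le_trans _ _ (\sum_o iid p o * \sum_(j in S) hit j * (j \notin seen o)%:R)).
  by rewrite ler_sum // => o _; rewrite ler_wpM2l ?missed_le_sum.
under eq_bigr do rewrite mulr_sumr.
rewrite exchange_big mulr_natl -sumr_const ler_sum // => j _ /=.
apply: le_trans (mul_exp_compl_le m_gt0 (hit_itv j)).
have -> : 1 - hit j = prob p (fun i => j \notin supp i).
  by rewrite /hit (probC _ p_distr) subKr.
rewrite -prob_iid_all probE mulr_sumr ler_sum // => o _.
rewrite mulrCA ler_wpM2l ?(andP (hit_itv j)).1 // ler_wpM2l // ler_nat.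
case: (boolP (j \in seen o)) => // j_unseen; case: forallP => // -[k].
by apply: contra j_unseen => jk; apply/bigcupP; exists k.
Qed.

Lemma prob_missed_le (c : R) : 0 < c ->
  1 - #|S|%:R / m%:R / c <= prob (iid p) (fun o => missed (seen o) <= c).
Proof.
move=> c0; apply: le_trans (markov (iid_distribution m p_distr) _ c0).
  by rewrite lerD2l lerN2 ler_pM2r ?invr_gt0 //; apply: mean_missed_le.
by move=> o; apply: sumr_ge0 => i _; case: p_distr.
Qed.

End SupportSampling.

(** * Estimating coordinates by interference *)

Section Phases.
Variable R : realType.
Local Notation C := R[i].

Definition phase (k : 'I_4) : C := 'i%C ^+ k.

Lemma mul_ii : 'i%C * 'i%C = -1 :> C.
Proof. by rewrite -expr2 sqr_i. Qed.

Lemma abs2_phase k : abs2 (phase k) = 1.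
Proof.
have i1 : abs2 'i%C = 1 :> R by rewrite abs2E /= expr0n add0r expr1n.
by rewrite /phase; elim: (k : nat) => [|j IH]; rewrite ?abs2_1 // exprS abs2M i1 mul1r.
Qed.

Lemma mulJ_phase k : (phase k)^* * phase k = 1.
Proof. by rewrite mulJc abs2_phase. Qed.

Lemma sum_phase : \sum_k phase k = 0.
Proof. by rewrite !big_ord_recr big_ord0 /phase /= !exprSr expr0 !mul1r mul_ii; ring. Qed.

Lemma sum_sqr_phase : \sum_k phase k ^+ 2 = 0.
Proof.
under eq_bigr do rewrite /phase -exprM mulnC exprM sqr_i.
by rewrite !big_ord_recr big_ord0 /=; ring.
Qed.

Lemma sum_phase_gram (d d' : bool) :
  \sum_k phase k ^+ d * (phase k ^+ d')^* = 4 * (d == d')%:R.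
Proof.
case: d d' => [] []; rewrite ?expr0 ?mulr1 ?mulr0.
- by under eq_bigr do rewrite mulrC mulJ_phase; rewrite sumr_const card_ord.
- by under eq_bigr do rewrite conjc1 mulr1; rewrite sum_phase.
- by under eq_bigr do rewrite mul1r; rewrite -conjc_sum sum_phase conjc0.
- by under eq_bigr do rewrite conjc1 mulr1; rewrite sumr_const card_ord.
Qed.

End Phases.

Arguments phase {R} k.

Section Interference.
Variables (R : realType) (J : finType).
Local Notation C := R[i].
Variables (F : {set J}) (e : J -> C).
Hypothesis e_unit : sqnorm e = 1.
Hypothesis F_gt0 : (0 < #|F|)%N.
Local Notation O := ('I_4 * J + bool * J)%type.

Definition root_card : C := (Num.sqrt #|F|%:R)%:C.

(* Outcome [inl (k, j)] interferes the reference e on the first copy with the j-th basis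
   vector on the second copy under the phase i^k; the outcomes [inr] are the columns of
   the projection onto the orthogonal complement. *)
Definition interf (o : O) (x : bool * J) : C :=
  match o with
  | inl (k, j) => (j \in F)%:R * 2^-1 *
      (phase k ^+ x.1 * (if x.1 then (x.2 == j)%:R else root_card^-1 * e x.2))
  | inr (d, j) => (x.1 == d)%:R *
      (if x.1 then (x.2 \notin F)%:R * (x.2 == j)%:R else (x.2 == j)%:R - e x.2 * (e j)^*)
  end.

Lemma sqr_root_card : root_card ^+ 2 = #|F|%:R.
Proof. by rewrite -rmorphXn /= sqr_sqrtr ?ler0n // rmorph_nat. Qed.

Lemma root_card_neq0 : root_card != 0.
Proof. by rewrite fmorph_eq0 gt_eqF // sqrtr_gt0 ltr0n. Qed.

Lemma conj_root_card : root_card^* = root_card.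
Proof. exact: conjc_real. Qed.

Lemma interf_inl_gram x x' :
  \sum_kj interf (inl kj) x * (interf (inl kj) x')^* =
  (x.1 == x'.1)%:R *
    (if x.1 then (x.2 \in F)%:R * (x.2 == x'.2)%:R else e x.2 * (e x'.2)^*).
Proof.
pose u (y : bool * J) j : C := if y.1 then (y.2 == j)%:R else root_card^-1 * e y.2.
transitivity (\sum_j (j \in F)%:R * (u x j * (u x' j)^*) *
    (4^-1 * \sum_k phase k ^+ x.1 * (phase k ^+ x'.1)^*)).
  under [RHS]eq_bigr do rewrite !mulr_sumr.
  rewrite exchange_big pair_bigA; apply: eq_bigr => -[k j] _ /=.
  rewrite !conjcM conjc_nat conjc_inv conjc_nat -!/(u _ j).
  by case: (j \in F); rewrite ?mul0r // !mul1r; field.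
rewrite -mulr_suml sum_phase_gram mulKf ?pnatr_eq0 // mulrC.
case: x x' => [d i] [d' i']; rewrite /u /=.
have [<-{d'}|_] := eqVneq d d'; last by rewrite !mul0r.
rewrite !mul1r; case: d.
  under eq_bigr do rewrite conjc_nat mulrCA.
  by rewrite sum_deltal [i' == i]eq_sym.
under eq_bigr do rewrite conjcM conjc_inv conj_root_card.
rewrite -mulr_suml sum_mem -sqr_root_card; field; exact: root_card_neq0.
Qed.

Lemma interf_inr_gram x x' :
  \sum_dj interf (inr dj) x * (interf (inr dj) x')^* =
  (x.1 == x'.1)%:R * (if x.1 then (x.2 \notin F)%:R * (x.2 == x'.2)%:R
                      else (x.2 == x'.2)%:R - e x.2 * (e x'.2)^*).
Proof.
case: x x' => [d i] [d' i'] /=; pose u b (y : J) j : C :=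
  if b then (y \notin F)%:R * (y == j)%:R else (y == j)%:R - e y * (e j)^*.
transitivity (\sum_b (d == b)%:R * ((d' == b)%:R * \sum_j u d i j * (u d' i' j)^*)).
  under [RHS]eq_bigr do rewrite !mulr_sumr.
  rewrite pair_bigA; apply: eq_bigr => -[b j] _ /=.
  by rewrite conjcM conjc_nat -!/(u _ _ j); ring.
rewrite sum_deltal [d' == d]eq_sym.
have [<-{d'}|_] := eqVneq d d'; last by rewrite !mul0r.
rewrite !mul1r /u; case: d => {u}.
  transitivity (\sum_j (i == j)%:R *
      ((i \notin F)%:R * (i' \notin F)%:R * (i' == j)%:R) : C).
    by apply: eq_bigr => j _; rewrite conjcM !conjc_nat; ring.
  rewrite sum_deltal eq_sym; have [->|_] := eqVneq i i'; last by rewrite !mulr0.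
  by rewrite !mulr1 -natrM mulnb andbb.
transitivity (\sum_j ((i == j)%:R * ((i' == j)%:R - (e i')^* * e j)
    - (i' == j)%:R * (e i * (e j)^*) + e i * (e i')^* * (abs2 (e j))%:C)).
  by apply: eq_bigr => j _; rewrite rmorphB /= conjcM conjc_nat conjcK -mulJc; ring.
rewrite big_split sumrB /= !sum_deltal -mulr_sumr -(rmorph_sum (real_complex R)) /=.
by rewrite -/(sqnorm e) e_unit eq_sym; ring.
Qed.

Lemma interf_povm : povm interf.
Proof.
move=> x x'; rewrite big_sumType interf_inl_gram interf_inr_gram -[LHS]mulrDr.
case: x x' => [d i] [d' i'] /=; rewrite xpair_eqE -mulnb natrM; congr (_ * _).
case: d; last by rewrite addrC subrK.
by case: (i \in F); rewrite ?mul1r ?mul0r ?addr0 ?add0r.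
Qed.

Variable alpha : J -> C.
Hypothesis alpha_unit : sqnorm (doubled alpha) = 1.

Local Notation p := (born interf (doubled alpha)).

Lemma interf_distribution : distribution p.
Proof. exact: born_distribution interf_povm alpha_unit. Qed.

Lemma dot_interf_inl k j : dot (interf (inl (k, j))) (doubled alpha) =
  (j \in F)%:R * 2^-1 * (root_card^-1 * dot e alpha + (phase k)^* * alpha j).
Proof.
rewrite /dot sum_bool_prod addrC mulrDr; congr (_ + _).
  rewrite !mulr_sumr; apply: eq_bigr => i _; rewrite /doubled /= !conjcM conjc1.
  by rewrite !conjc_inv conj_root_card !conjc_nat; ring.
rewrite -(sum_delta_sym j (fun i => (phase k)^* * alpha i)) mulr_sumr.
apply: eq_bigr => i _; rewrite /doubled /= !conjcM conjc_inv !conjc_nat; ring.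
Qed.

Definition observable (o : O) (l : J) : C :=
  match o with
  | inl (k, j) => (j \in F)%:R * ((j == l)%:R * (root_card * phase k))
  | inr _ => 0
  end.

Lemma observable_mean l : l \in F ->
  \sum_o (p o)%:C * observable o l = (dot e alpha)^* * alpha l.
Proof.
move=> lF; rewrite big_sumType /=.
rewrite [X in _ + X]big1 ?addr0 => [|j _]; last by rewrite mulr0.
transitivity (\sum_j (j == l)%:R * \sum_k (p (inl (k, j)))%:C *
    ((j \in F)%:R * (root_card * phase k))).
  under [RHS]eq_bigr do rewrite mulr_sumr.
  by rewrite exchange_big pair_bigA; apply: eq_bigr => -[k j] _ /=; ring.
rewrite sum_delta_sym lF; have := root_card_neq0; set r := root_card => r_neq0.
set g := dot e alpha; set al := alpha l.
transitivity (\sum_k (4^-1 * r^-1 * (g^* * g) * phase k + 4^-1 * (al^* * g) * phase k ^+ 2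
    + (4^-1 * r * (al^* * al) * phase k + 4^-1 * (g^* * al)) * ((phase k)^* * phase k))).
  apply: eq_bigr => k _; rewrite /born dot_interf_inl lF -mulJc !mul1r -/r -/g -/al.
  rewrite !conjcM conjcD !conjcM conjcK !conjc_inv conjc_nat conj_root_card -/r.
  by field; exact: r_neq0.
under eq_bigr do rewrite mulJ_phase mulr1.
rewrite !big_split /= -!mulr_sumr sum_phase sum_sqr_phase sumr_const card_ord -mulr_natl.
by field.
Qed.

Lemma observable_moment : \sum_(l in F) \sum_o p o * abs2 (observable o l) <= #|F|%:R.
Proof.
have [p0 p1] := interf_distribution; rewrite exchange_big /=.
apply: (@le_trans _ _ (\sum_o p o * #|F|%:R)); last by rewrite -mulr_suml p1 mul1r.
rewrite ler_sum // => o _; rewrite -mulr_sumr ler_wpM2l //.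
case: o => [[k j]|j] /=; last by rewrite big1 ?ler0n // => l _; rewrite abs2_0.
apply: (@le_trans _ _ (\sum_l (j == l)%:R * #|F|%:R)); last by rewrite sum_deltal.
rewrite big_mkcond ler_sum // => l _.
rewrite !abs2M !abs2_bool abs2_real sqr_sqrtr ?ler0n // abs2_phase mulr1.
by case: (l \in F); case: (j \in F); rewrite ?mul0r ?mul1r ?mulr_ge0 ?ler0n.
Qed.

Variable m : nat.

Definition estimate (o : {ffun 'I_m -> O}) (l : J) : C :=
  (m%:R^-1)%:C * \sum_k observable (o k) l.

Lemma estimate_off o l : l \notin F -> estimate o l = 0.
Proof.
move=> lF; rewrite /estimate big1 ?mulr0 // => k _.
case: (o k) => [[c j]|j] //=; have [->|_] := eqVneq j l; last by rewrite mul0r mulr0.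
by rewrite (negPf lF) mul0r.
Qed.

Definition estimation_error (o : {ffun 'I_m -> O}) : R :=
  \sum_(l in F) abs2 (estimate o l - (dot e alpha)^* * alpha l).

Lemma sqnorm_estimate_error (B : {set J}) o : F \subset B ->
  sqnorm (fun l => estimate o l - (dot e alpha)^* * restrict B alpha l) =
  estimation_error o + abs2 (dot e alpha) * \sum_(l in B :\: F) abs2 (alpha l).
Proof.
move=> FB; rewrite mulr_sumr /sqnorm (bigID [in F]) /=; congr (_ + _).
  by apply: eq_bigr => l /(fintype.subsetP FB) lB; rewrite /restrict lB mul1r.
rewrite big_mkcond [RHS]big_mkcond; apply: eq_bigr => l _; rewrite inE /restrict.
case: (boolP (l \in F)) => //= lF.
rewrite estimate_off // sub0r abs2N abs2M abs2_conj.
by case: (l \in B); rewrite ?mul1r // mul0r abs2_0 mulr0.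
Qed.

Lemma prob_estimation_error_le (c : R) : (0 < m)%N -> 0 < c ->
  1 - #|F|%:R / m%:R / c <= prob (iid p) (fun o => estimation_error o <= c).
Proof.
move=> m_gt0 c0.
have error_ge0 o : 0 <= estimation_error o by apply: sumr_ge0 => l _; apply: abs2_ge0.
apply: le_trans (markov (iid_distribution m interf_distribution) error_ge0 c0).
rewrite lerD2l lerN2 ler_pM2r ?invr_gt0 //.
under eq_bigr do rewrite mulr_sumr.
rewrite exchange_big /=.
apply: (@le_trans _ _ (\sum_(l in F) m%:R^-1 * \sum_o p o * abs2 (observable o l))).
  apply: ler_sum => l lF; rewrite -(observable_mean lF).
  exact: (iid_variance_complex interf_distribution (observable^~ l)).
by rewrite -mulr_sumr [leRHS]mulrC ler_wpM2l ?invr_ge0 ?ler0n ?observable_moment.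
Qed.

End Interference.

(** * The learning algorithm *)

Section Windows.
Variable n : nat.
Local Notation Bv := (bitvec n).
Local Notation J := (bool * (Bv * Bv))%type.
Implicit Types (S : {set 'I_n}) (B : {set J}).

Definition comp_block : {set J} := [set j | ~~ j.1 & j.2.2 == zerov]%SET.

Definition pauli_block : {set J} := [set j | j.1]%SET.

Definition window B S : {set J} := [set j in B | coord_support j \subset S]%SET.

Definition bits_within S : {set Bv} := [set p : Bv | [set l | p l]%SET \subset S]%SET.

Lemma window_subset B S : window B S \subset B.
Proof. by apply/fintype.subsetP => j; rewrite inE => /andP[]. Qed.

Lemma card_bits_within S : (#|bits_within S| <= 2 ^ #|S|)%N.
Proof.
have set_inj : injective (fun p : Bv => [set l | p l]%SET).
  by move=> p q /setP pq; apply/ffunP => l; have := pq l; rewrite !inE.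
rewrite -(card_imset _ set_inj) -card_powerset; apply: subset_leq_card.
by apply/fintype.subsetP => _ /imsetP[p p_in ->]; rewrite !inE in p_in *.
Qed.

Lemma bits_within_support S c p r : coord_support (c, (p, r)) \subset S =
  (p \in bits_within S) && (r \in bits_within S).
Proof.
have -> : coord_support (c, (p, r)) = ([set l | p l] :|: [set l | r l])%SET.
  by apply/setP => l; rewrite !inE.
by rewrite !inE finset.subUset.
Qed.

Lemma card_comp_window S : (#|window comp_block S| <= 2 ^ #|S|)%N.
Proof.
apply: leq_trans (card_bits_within S).
apply: leq_trans (leq_imset_card (fun p => (false, (p, zerov))) _).
apply/subset_leq_card/fintype.subsetP => -[c [p r]].
rewrite inE bits_within_support inE /= => /andP[/andP[/negPf -> /eqP ->] /andP[p_in _]].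
exact: imset_f.
Qed.

Lemma card_pauli_window S : (#|window pauli_block S| <= 4 ^ #|S|)%N.
Proof.
apply: (@leq_trans #|finset.setX (bits_within S) (bits_within S)|); last first.
  by rewrite cardsX -[4%N]/(2 * 2)%N expnMn leq_mul ?card_bits_within.
apply: leq_trans (leq_imset_card (pair true) _).
apply/subset_leq_card/fintype.subsetP => -[c [p r]].
rewrite inE bits_within_support inE /= => /andP[-> pr_in].
by apply: imset_f; rewrite inE.
Qed.

Lemma window_gt0 B S c : (c, (zerov, zerov)) \in B -> (0 < #|window B S|)%N.
Proof.
move=> zeroB; apply/card_gt0P; exists (c, (zerov, zerov)); rewrite inE zeroB.
rewrite bits_within_support andbb inE; apply/fintype.subsetP => l.
by rewrite inE ffunE.
Qed.

Lemma comp_window_gt0 S : (0 < #|window comp_block S|)%N.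
Proof. by apply: (@window_gt0 _ _ false); rewrite inE eqxx. Qed.

Lemma pauli_window_gt0 S : (0 < #|window pauli_block S|)%N.
Proof. by apply: (@window_gt0 _ _ true); rewrite inE. Qed.

End Windows.

Arguments comp_block {n}.
Arguments pauli_block {n}.

Section JuntaCoordinates.
Variables (R : realType) (n : nat).
Local Notation C := R[i].
Local Notation N := (2 ^ n)%N.
Local Notation Bv := (bitvec n).
Local Notation J := (bool * (Bv * Bv))%type.
Implicit Types (S : {set 'I_n}) (B : {set J}) (U W : 'M[C]_N).

Definition missed_weight U S : R :=
  missed (abs2 \o doubled (coord U)) (fun i => coord_support i.2) S.

Lemma basis_distribution U : unitary U -> distribution (abs2 \o doubled (coord U)).
Proof. by move=> uU; split=> [i|]; [apply: abs2_ge0 | apply: sqnorm_doubled_coord]. Qed.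

Lemma sum_window_compl_le B S U :
  \sum_(j in B :\: window B S) abs2 (coord U j) <= missed_weight U S.
Proof.
rewrite /missed_weight /missed probE.
rewrite (sum_doubled (fun j => abs2 (coord U j) * (~~ (coord_support j \subset S))%:R)).
rewrite -[leLHS]addr0; apply: lerD; last first.
  by apply: sumr_ge0 => j _; rewrite mulr_ge0 ?abs2_ge0.
rewrite big_mkcond ler_sum // => j _; rewrite !inE.
by case: (j \in B); case: (_ \subset S); rewrite /= ?mulr1 ?mulr0 ?abs2_ge0.
Qed.

Lemma sqnorm_restrict_comp U :
  unitary U -> sqnorm (restrict comp_block (coord U)) = 49 / 100.
Proof.
move=> uU; rewrite -(sqnorm_coord_comp uU) /sqnorm sum_bool_prod.
rewrite [X in X + _]big1 ?add0r => [|pr _]; last by rewrite /restrict inE mul0r abs2_0.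
apply: eq_bigr => -[p r] _; rewrite /restrict inE /=.
by have [->|/negPf r0] := eqVneq r zerov; rewrite ?mul1r // coord_comp r0 !mulr0.
Qed.

Lemma sqnorm_restrict_pauli U :
  sqnorm (restrict pauli_block (coord U)) = (100 * N%:R)^-1 * sqnorm (entries U).
Proof.
rewrite -sqnorm_coord_pauli /sqnorm sum_bool_prod.
rewrite [X in _ + X]big1 ?addr0 => [|pr _]; last by rewrite /restrict inE mul0r abs2_0.
by apply: eq_bigr => pr _; rewrite /restrict inE mul1r.
Qed.

Lemma prob_large_coord S U : junta_on S U ->
  24 / 25 <= prob (abs2 \o doubled (coord U))
    (fun i => (100 * 2 ^+ #|S|)^-1 <= abs2 (coord U i.2)).
Proof.
move=> US; have uU := junta_on_unitary US; set t := (100 * _)^-1.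
have t0 : 0 <= t by rewrite invr_ge0 mulr_ge0 ?exprn_ge0.
rewrite probC; last exact: basis_distribution.
pose small_weight j := abs2 (coord U j) * (~~ (t <= abs2 (coord U j)))%:R.
suff : \sum_j small_weight j <= 1 / 50.
  by rewrite probE [X in _ - X](sum_doubled small_weight); lra.
have small_weight_le j : small_weight j <=
    j.1%:R * abs2 (coord U j) + (j \in window comp_block S)%:R * t.
  rewrite /small_weight; case: (leP t (abs2 (coord U j))) => /= [_|small].
    by rewrite mulr0 addr_ge0 // mulr_ge0 ?abs2_ge0 ?ler0n.
  rewrite mulr1; case: j small => -[] [p r] small; first by rewrite mul1r lerDl mulr_ge0.
  have [->|nz] := eqVneq (coord U (false, (p, r))) 0.
    by rewrite abs2_0 mulr0 add0r mulr_ge0.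
  have r0 : r == zerov by apply: contraNT nz => /negPf r0; rewrite coord_comp r0 !mulr0.
  by rewrite !inE (junta_coord_support US) //= r0 mul0r add0r mul1r ltW.
apply: le_trans (ler_sum _ (fun j _ => small_weight_le j)) _; rewrite big_split /=.
rewrite sum_bool_prod /= [X in _ + X + _]big1 => [|pr _]; last by rewrite mul0r.
under eq_bigr do rewrite mul1r.
rewrite sqnorm_coord_pauli sqnorm_unitary // -mulr_suml.
rewrite sum_mem addr0 invfM mulfVK ?gt_eqF ?natr_dim_gt0 //.
have cardW : #|window comp_block S|%:R <= 2 ^+ #|S| :> R.
  by rewrite -natrX ler_nat card_comp_window.
suff : #|window comp_block S|%:R * t <= 1 / 100 by lra.
by rewrite ler_pdivrMr ?mulr_gt0 ?exprn_gt0 //; lra.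
Qed.

(* The fit is up to a complex factor, which absorbs the unknown overlap of the reference. *)
Definition pauli_fit (tau : R) (b : J -> C) W :=
  exists r, sqnorm (fun j => b j - r * restrict pauli_block (coord W) j) <= tau.

Definition fitted (tau : R) (b : J -> C) : 'M[C]_N :=
  xget 1%:M [set W | unitary W /\ pauli_fit tau b W]%classic.

Lemma fitted_unitary tau b : unitary (fitted tau b).
Proof. by rewrite /fitted; case: xgetP => [W _ []|_] //; apply: unitary1. Qed.

Lemma fitted_fit tau b U :
  unitary U -> pauli_fit tau b U -> pauli_fit tau b (fitted tau b).
Proof.
pose fits := [set W | unitary W /\ pauli_fit tau b W]%classic.
by move=> uU fitU; case: (@xgetI _ 1%:M fits U (conj uU fitU)).
Qed.

Lemma qdist_le_fit U W (b : J -> C) (k : C) (tau eps : R) :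
  unitary U -> unitary W -> 0 <= eps -> 1 / 4 <= abs2 k -> 1600 * tau <= eps ^+ 2 ->
  sqnorm (fun j => b j - k * restrict pauli_block (coord U) j) <= tau ->
  pauli_fit tau b W -> qdist U W <= eps.
Proof.
move=> uU uW eps0 k_large tau_small fitU [r fitW].
have kneq0 : k != 0 by rewrite -abs2_eq0 gt_eqF //; lra.
have N0 := natr_dim_gt0 R n.
have close : sqnorm (restrict pauli_block (coord (r *: W - k *: U))) <= 4 * tau.
  rewrite (_ : sqnorm _ = sqnorm (fun j => r * restrict pauli_block (coord W) j -
      k * restrict pauli_block (coord U) j)).
    by apply: le_trans (sqnorm_dist_le _ b _) _; rewrite sqnorm_distC in fitW; lra.
  by apply: eq_bigr => j _; rewrite /restrict coord_lin; congr abs2; ring.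
apply: (qdist_le_scaled (pow2_gt0 n) uU uW eps0 kneq0) => //.
move: close; rewrite sqnorm_restrict_pauli ler_pdivrMl ?mulr_gt0 // => close.
apply: le_trans close _; have -> : 100 * N%:R * (4 * tau) = 400 * tau * N%:R by ring.
rewrite ler_pM2r //; have := ler_wpM2l (sqr_ge0 eps) k_large; lra.
Qed.

End JuntaCoordinates.

Section Stages.
Variables (R : realType) (n m : nat).
Local Notation C := R[i].
Local Notation J := (bool * (bitvec n * bitvec n))%type.
Local Notation O := ('I_4 * J + bool * J)%type.
Variables (S S' : {set 'I_n}) (U : 'M[C]_(2 ^ n)).
Hypothesis US : junta_on S U.
Local Notation k := #|S|.
Hypothesis m_large : 10 ^+ 6 * 4 ^+ k <= m%:R :> R.
Hypothesis missed_small : missed_weight U S' <= 50 * 4 ^+ k / m%:R.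
Implicit Type o : {ffun 'I_m -> O}.

Let uU := junta_on_unitary US.

Let m_gt0 : 0 < m%:R :> R.
Proof. by apply: lt_le_trans m_large; rewrite mulr_gt0 ?exprn_gt0. Qed.

Lemma window_error_le B (e : J -> C) (c : R) o :
  estimation_error (window B S') e (coord U) o <= c ->
  sqnorm (fun l => estimate R (window B S') o l -
      (dot e (coord U))^* * restrict B (coord U) l)
    <= c + abs2 (dot e (coord U)) * (50 * 4 ^+ k / m%:R).
Proof.
move=> error; rewrite (sqnorm_estimate_error _ _ _ (window_subset B S')).
rewrite lerD // ler_wpM2l ?abs2_ge0 //.
exact: le_trans (sum_window_compl_le B S' U) missed_small.
Qed.

Lemma learned_column_overlap j0 o : (100 * 2 ^+ k)^-1 <= abs2 (coord U j0) ->
  estimation_error (window comp_block S') (ket R j0) (coord U) o <= 50 * 2 ^+ k / m%:R ->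
  1 / 4 <= abs2 (dot (normalize (ket R j0) (estimate R (window comp_block S') o))
                     (coord U)).
Proof.
set est := estimate _ _ o => large /window_error_le; rewrite -/est dot_ketl.
set a := coord U j0 in large *; set two_pow : R := 2 ^+ k in large *; move=> error.
have two_pow_gt0 : 0 < two_pow by rewrite exprn_gt0.
have four_powE : 4 ^+ k = two_pow * two_pow by rewrite -exprMn; congr (_ ^+ _); ring.
have scaled_large : 1 <= abs2 a * (100 * two_pow).
  by rewrite -ler_pdivrMr ?mulr_gt0 // div1r.
have a_gt0 : 0 < abs2 a by apply: lt_le_trans large; rewrite invr_gt0 mulr_gt0.
have estimation : 50 * two_pow / m%:R <= abs2 a * 200^-1.
  rewrite ler_pdivrMr //; move: m_large; rewrite four_powE => large_m.
  have := ler_wpM2l (ltW a_gt0) large_m.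
  have := ler_wpM2l (ltW two_pow_gt0) scaled_large; lra.
have missing : 50 * 4 ^+ k / m%:R <= 200^-1 :> R.
  have four_pow_ge0 : 0 <= 4 ^+ k :> R by rewrite exprn_ge0.
  by rewrite ler_pdivrMr //; move: m_large; lra.
have close : sqnorm (fun l => est l - a^* * restrict comp_block (coord U) l) <=
    abs2 a^* * sqnorm (restrict comp_block (coord U)) / 4.
  rewrite sqnorm_restrict_comp // abs2_conj; apply: le_trans error _.
  have := ler_wpM2l (ltW a_gt0) missing; lra.
have [||est_gt0] := overlap_of_close _ _ close.
- by rewrite sqnorm_restrict_comp //; lra.
- by rewrite -abs2_eq0 abs2_conj gt_eqF.
rewrite sqnorm_restrict_comp // dot_restrict => [overlap|l l_off].
  by rewrite abs2_dot_normalize // ler_pdivlMr //; lra.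
rewrite /est estimate_off //; apply: contra (fintype.subsetP (window_subset _ _) l) _.
by rewrite inE in l_off.
Qed.

Lemma learned_paulis_close (e : J -> C) o : sqnorm e = 1 ->
  estimation_error (window pauli_block S') e (coord U) o <= 50 * 4 ^+ k / m%:R ->
  sqnorm (fun l => estimate R (window pauli_block S') o l -
      (dot e (coord U))^* * restrict pauli_block (coord U) l) <= 100 * 4 ^+ k / m%:R.
Proof.
move=> e1 /window_error_le error; apply: le_trans error _.
have overlap1 : abs2 (dot e (coord U)) <= 1.
  by apply: le_trans (cauchy_schwarz _ _) _; rewrite e1 sqnorm_coord //; lra.
have weight_ge0 : 0 <= 50 * 4 ^+ k / m%:R :> R.
  by rewrite divr_ge0 ?mulr_ge0 ?exprn_ge0 ?ltW.
have := ler_wpM2r weight_ge0 overlap1; lra.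
Qed.

End Stages.

Lemma compl_ratio_ge (R : realFieldType) (x K m : R) : 0 < K -> 0 < m -> x <= K ->
  1 - 1 / 50 <= 1 - x / m / (50 * K / m).
Proof.
move=> K0 m0 xK; rewrite lerD2l lerN2 ler_pdivrMr ?divr_gt0 ?mulr_gt0 //.
have -> : 1 / 50 * (50 * K / m) = K / m by field; rewrite gt_eqF.
by rewrite ler_pM2r ?invr_gt0.
Qed.

Section Learner.
Variables (R : realType) (n k m' : nat).
Local Notation C := R[i].
Local Notation N := (2 ^ n)%N.
Local Notation J := (bool * (bitvec n * bitvec n))%type.
Local Notation I := (bool * J)%type.
Local Notation O := ('I_4 * J + bool * J)%type.
Local Notation m := m'.+1.
Implicit Types (oA : {ffun 'I_m -> I}) (oB oC : {ffun 'I_m -> O}) (a : I -> C)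
  (F : {set J}) (e : J -> C).

Definition found_set oA : {set 'I_n} := seen (fun i : I => coord_support i.2) oA.

Definition reference oA : J -> C := ket R (oA ord0).2.

Definition learned_reference oA oB : J -> C :=
  normalize (reference oA) (estimate R (window comp_block (found_set oA)) oB).

Definition learned_unitary
    (o : {ffun 'I_m -> I} * ({ffun 'I_m -> O} * {ffun 'I_m -> O})) : 'M[C]_N :=
  fitted (100 * 4 ^+ k / m%:R) (estimate R (window pauli_block (found_set o.1)) o.2.2).

Lemma learned_unitaryP o : unitary (learned_unitary o).
Proof. exact: fitted_unitary. Qed.

Definition interf_law (F : {set J}) (e : J -> C) a : {ffun 'I_m -> O} -> R :=
  iid (born (interf F e) a).

Definition comp_law oA := interf_law (window comp_block (found_set oA)) (reference oA).

Definition pauli_law oA oB :=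
  interf_law (window pauli_block (found_set oA)) (learned_reference oA oB).

Definition learner_law a :=
  chain (iid (abs2 \o a)) (fun oA => chain (comp_law oA a) (fun oB => pauli_law oA oB a)).

Lemma sqnorm_reference oA : sqnorm (reference oA) = 1.
Proof. exact: sqnorm_ket. Qed.

Lemma sqnorm_learned_reference oA oB : sqnorm (learned_reference oA oB) = 1.
Proof. exact/sqnorm_normalize/sqnorm_reference. Qed.

Lemma interf_law_samplable F e :
  sqnorm e = 1 -> (0 < #|F|)%N -> samplable m (interf_law F e).
Proof. by move=> e1 F0; apply/samplable_iid/interf_povm. Qed.

Lemma learner_samplable : samplable (m + (m + m)) learner_law.
Proof.
apply: (samplable_chain
  (P2 := fun oA a => chain (comp_law oA a) (fun oB => pauli_law oA oB a))).
  exact: samplable_basis.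
move=> oA; apply: (samplable_chain (P1 := comp_law oA) (P2 := pauli_law oA)) => [|oB].
  by apply: interf_law_samplable; rewrite ?sqnorm_reference ?comp_window_gt0.
by apply: interf_law_samplable; rewrite ?sqnorm_learned_reference ?pauli_window_gt0.
Qed.

Section Success.
Variables (S : {set 'I_n}) (U : 'M[C]_N).
Hypothesis US : junta_on S U.
Hypothesis cardS : #|S| = k.
Local Notation alpha := (doubled (coord U)).

Let uU := junta_on_unitary US.

Lemma interf_law_distribution F e : sqnorm e = 1 -> (0 < #|F|)%N ->
  distribution (interf_law F e alpha).
Proof.
by move=> e1 F0; apply/iid_distribution/interf_distribution/sqnorm_doubled_coord.
Qed.

Definition good_start oA := [&& found_set oA \subset S,
  missed_weight U (found_set oA) <= 50 * 4 ^+ k / m%:R &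
  (100 * 2 ^+ k)^-1 <= abs2 (coord U (oA ord0).2)].

Lemma prob_good_start : 47 / 50 <= prob (iid (abs2 \o alpha)) good_start.
Proof.
have dist := basis_distribution uU; have iid_dist := iid_distribution m dist.
have supp (i : I) : (abs2 \o alpha) i != 0 -> coord_support i.2 \subset S.
  by rewrite /= abs2_eq0; apply: junta_coord_support.
have -> : 47 / 50 = 1 - (0 + (1 / 50 + 1 / 25)) :> R by lra.
apply: union_bound => //.
  by rewrite prob_almost_surely ?subr0 // => oA; apply: seen_subset.
apply: union_bound => //.
  have c0 : 0 < 50 * 4 ^+ k / m%:R :> R by rewrite divr_gt0 ?mulr_gt0 ?exprn_gt0.
  apply: le_trans (prob_missed_le dist supp (ltn0Sn m') c0).
  apply: compl_ratio_ge; rewrite ?exprn_gt0 //.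
  by rewrite -natrX ler_nat cardS ltnW // ltn_expl.
rewrite (prob_iid_coord dist ord0
  (fun i : I => (100 * 2 ^+ k)^-1 <= abs2 (coord U i.2))) -cardS.
by apply: le_trans (prob_large_coord US); lra.
Qed.

Definition estimate_close F e (K : R) (o : {ffun 'I_m -> O}) :=
  estimation_error F e (coord U) o <= 50 * K / m%:R.

Lemma prob_estimate_close F e (K : R) :
  sqnorm e = 1 -> (0 < #|F|)%N -> 0 < K -> #|F|%:R <= K ->
  1 - 1 / 50 <= prob (interf_law F e alpha) (estimate_close F e K).
Proof.
move=> e1 F0 K0 FK; have c0 : 0 < 50 * K / m%:R by rewrite divr_gt0 ?mulr_gt0.
apply: le_trans (prob_estimation_error_le e1 F0 (sqnorm_doubled_coord uU) (ltn0Sn m') c0).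
exact: compl_ratio_ge.
Qed.

Variable eps : R.
Hypothesis eps_itv : 0 < eps <= 1.
Hypothesis m_large : 10 ^+ 6 * 4 ^+ k <= m%:R * eps ^+ 2.

Lemma qdist_learned_unitary oA oB oC : good_start oA ->
  estimate_close (window comp_block (found_set oA)) (reference oA) (2 ^+ k) oB ->
  estimate_close (window pauli_block (found_set oA)) (learned_reference oA oB)
    (4 ^+ k) oC ->
  qdist U (learned_unitary (oA, (oB, oC))) <= eps.
Proof.
have [eps0 eps1] := andP eps_itv.
have m_large1 : 10 ^+ 6 * 4 ^+ #|S| <= m%:R :> R.
  by rewrite cardS; apply: le_trans m_large _; rewrite ler_piMr // exprn_ile1 // ltW.
rewrite /good_start /estimate_close -cardS.
move=> /and3P[_ missed_small large] comp_error pauli_error.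
have overlap := learned_column_overlap US m_large1 missed_small large comp_error.
have close := learned_paulis_close US m_large1 missed_small
  (sqnorm_learned_reference oA oB) pauli_error.
apply: (qdist_le_fit uU (learned_unitaryP _) (ltW eps0) _ _ close).
- by rewrite abs2_conj.
- rewrite cardS mulrA ler_pdivrMr //; have : 0 <= 4 ^+ k :> R by rewrite exprn_ge0.
  by move: m_large; lra.
rewrite /learned_unitary -cardS; apply: (fitted_fit uU).
by exists (dot (learned_reference oA oB) (coord U))^*.
Qed.

Lemma learner_success :
  9 / 10 <= prob (learner_law alpha) (fun o => qdist U (learned_unitary o) <= eps).
Proof.
have pauli_dist oA oB : distribution (pauli_law oA oB alpha).
  by apply: interf_law_distribution; rewrite ?sqnorm_learned_reference ?pauli_window_gt0.
have comp_dist oA : distribution (comp_law oA alpha).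
  by apply: interf_law_distribution; rewrite ?sqnorm_reference ?comp_window_gt0.
have start_dist := iid_distribution m (basis_distribution uU).
apply: (@le_trans _ _ (47 / 50 * ((1 - 1 / 50) * (1 - 1 / 50)))); first by lra.
apply: (prob_chain_ge start_dist _ _ prob_good_start) => [oA||oA good_oA]; [|by lra|].
  exact: chain_distribution.
have [found_S _ _] := and3P good_oA.
have comp_card : #|window comp_block (found_set oA)|%:R <= 2 ^+ k :> R.
  rewrite -natrX ler_nat; apply: leq_trans (card_comp_window _) _.
  by rewrite leq_exp2l // -cardS subset_leq_card.
have pauli_card : #|window pauli_block (found_set oA)|%:R <= 4 ^+ k :> R.
  rewrite -natrX ler_nat; apply: leq_trans (card_pauli_window _) _.
  by rewrite leq_exp2l // -cardS subset_leq_card.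
have comp_close := prob_estimate_close (sqnorm_reference oA) (comp_window_gt0 _)
  (exprn_gt0 k (ltr0Sn R 1)) comp_card.
apply: (prob_chain_ge (comp_dist oA) _ _ comp_close) => [//||oB comp_oB]; first by lra.
have pauli_close := prob_estimate_close (sqnorm_learned_reference oA oB)
  (pauli_window_gt0 _) (exprn_gt0 k (ltr0Sn R 3)) pauli_card.
apply: le_trans pauli_close _; apply: (prob_le (pauli_dist oA oB)) => oC pauli_oC.
exact: qdist_learned_unitary.
Qed.

End Success.
End Learner.

Lemma junta_learner (R : realType) (n k m : nat) (eps : R) :
  0 < eps <= 1 -> 10 ^+ 6 * 4 ^+ k <= m.+1%:R * eps ^+ 2 ->
  exists A : query_alg R n, nqueries A = (m.+1 + (m.+1 + m.+1))%N /\
    forall U, is_junta k U -> 9 / 10 <= success_prob A U eps.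
Proof.
move=> eps_itv m_large.
have card_register : #|{: bool * (bool * bitvec n)}| = (2 ^ n.+2)%N.
  by rewrite !card_prod card_ffun !card_bool card_ord !expnS.
have [A [A_queries A_success]] := samplable_circuit card_register (sqnorm_probe R n)
  (@probe_basis_povm R n) (@learner_samplable R n m)
  (@learned_unitaryP R n k m).
exists A; split=> // U /is_junta_junta_on[S [cardS US]].
apply: le_trans (A_success U eps); rewrite dot_probe_basis_copy.
exact: (learner_success US cardS eps_itv m_large).
Qed.

Lemma zero_query_algorithm (R : realType) (n : nat) : exists A : query_alg R n,
  nqueries A = 0 /\ forall U eps, unitary U -> 1 <= eps -> success_prob A U eps = 1.
Proof.
pose A := @QueryAlg R n 0 0 (fun=> 1%:M) (fun=> unitary1 R _) (fun=> 1%:M)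
  (fun=> unitary1 R _).
exists A; split=> // U eps uU eps1; rewrite /success_prob (eq_bigl xpredT) => [|o].
  rewrite /final_state /= mul1mx -(sqnorm_ket R (zero_idx n 0)).
  by apply: eq_bigr => o _; rewrite mxE eqxx andbT.
by rewrite (le_trans (qdist_le1 (pow2_gt0 n) uU (unitary1 R _)) eps1).
Qed.

Lemma exists_sample_count (R : realType) (y : R) : 1 <= y -> exists m : nat,
  10 ^+ 6 * y <= m.+1%:R /\ (m.+1 + (m.+1 + m.+1))%:R <= (4 * 10 ^ 6)%N%:R * y.
Proof.
move=> y1; have y0 : 0 <= 10 ^+ 6 * y.
  by rewrite mulr_ge0 ?exprn_ge0 // (le_trans ler01 y1).
have /andP[trunc_le trunc_gt] := truncn_itv y0.
exists (Num.truncn (10 ^+ 6 * y)); split; first exact: ltW.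
by rewrite !natrD -[_.+1%:R]natr1 natrM natrX; lra.
Qed.

Theorem mainTheorem5 :
  exists c : nat, (0 < c)%N /\
  forall (R : realType) (n k : nat) (eps : R), 0 < eps ->
  exists A : query_alg R n,
    (nqueries A)%:R <= c%:R * (k%:R / eps + 4%:R ^+ k / eps ^+ 2) /\
    forall U : 'M[R[i]]_(2 ^ n), is_junta k U ->
      9%:R / 10%:R <= success_prob A U eps.
Proof.
exists (4 * 10 ^ 6)%N; split; first by rewrite muln_gt0 expn_gt0.
move=> R n k eps eps0; have eps2 : 0 < eps ^+ 2 by rewrite exprn_gt0.
have ke0 : 0 <= k%:R / eps by rewrite divr_ge0 // ltW.
have [eps1|/ltW eps1] := lerP eps 1; last first.
  have [A [A_queries A_success]] := zero_query_algorithm R n.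
  exists A; split=> [|U /is_junta_junta_on[S [_ /junta_on_unitary uU]]].
    by rewrite A_queries mulr_ge0 // addr_ge0 // divr_ge0 ?exprn_ge0 // ltW.
  by rewrite A_success //; lra.
have ratio1 : 1 <= 4%:R ^+ k / eps ^+ 2.
  rewrite ler_pdivlMr // mul1r (@le_trans _ _ 1) ?exprn_ile1 ?(ltW eps0) //.
  by rewrite -natrX ler1n expn_gt0.
have [m [m_large m_small]] := exists_sample_count ratio1.
have [||A [A_queries A_success]] := @junta_learner R n k m eps; first by rewrite eps0.
  by rewrite -ler_pdivrMr // -mulrA.
exists A; split=> //; rewrite A_queries; apply: le_trans m_small _.
by rewrite ler_wpM2l // lerDr.
Qed.
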